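(* There is a constant $d$ such that the following holds. Let $\mathcal{M}=(n,Q,\Sigma,\Gamma,\Delta,q_0,\gamma_0,F)$ be an OMPA (in normal form) and $q\in Q$. Then it is possible to construct, in time $O(|\mathcal{M}|^{2^{dn}})$, an $\mathcal{M}$-automaton $\mathcal{A}$ with $|\mathcal{A}|=O(|\mathcal{M}|^{2^{dn}})$ and $L_{\mathcal{M}}(\mathcal{A})=\mathit{Pre}^*_{\mathcal{T}(\mathcal{M})}(\{(q,\bot,\dots,\bot)\})$.
   Context: For a finite alphabet $X$, $X_\epsilon=X\cup\{\epsilon\}$. A multi-pushdown automaton (MPA) is $\mathcal{M}=(n,Q,\Sigma,\Gamma,\Delta,q_0,\gamma_0,F)$ with $n\ge1$ stacks, finite nonempty state set $Q$, finite input alphabet $\Sigma$, finite stack alphabet $\Gamma\ni\bot$, $q_0\in Q$, $\gamma_0\in\Gamma\setminus\{\bot\}$, $F\subseteq Q$, and $\Delta\subseteq(Q\times(\Gamma_\epsilon)^n)\times\Sigma_\epsilon\times(Q\times(\Gamma^* )^n)$ such that for each transition $((q,\gamma_1,\dots,\gamma_n),a,(q',\alpha_1,\dots,\alpha_n))$ and each $i$: $|\alpha_i|\le2$; if $\gamma_i\ne\bot$ then $\alpha_i\in(\Gamma\setminus\{\bot\})^*$; if $\gamma_i=\bot$ then $\alpha_i=\alpha_i'\bot$ with $\alpha_i'\in(\Gamma\setminus\{\bot\})\cup\{\epsilon\}$. $|\mathcal{M}|=n+|Q|+|\Sigma|+|\Gamma|+|\Delta|$. $\mathit{Stack}(\mathcal{M})=(\Gamma\setminus\{\bot\})^*\bot$;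 configurations are $(q,w_1,\dots,w_n)$ with $w_i\in\mathit{Stack}(\mathcal{M})$; the transition system $\mathcal{T}(\mathcal{M})$ has steps $(q,\gamma_1w_1,\dots,\gamma_nw_n)\xrightarrow{a}(q',\alpha_1w_1,\dots,\alpha_nw_n)$ for each transition and all $w_i$ with $\gamma_iw_i\in\mathit{Stack}(\mathcal{M})$. An OMPA is an MPA where each transition has, for some $i$, $\gamma_1=\dots=\gamma_{i-1}=\bot$, $\gamma_i\in\Gamma_\epsilon$, $\gamma_{i+1}=\dots=\gamma_n=\epsilon$. Normal form: every transition is either (a) $((q,\gamma,\epsilon,\dots,\epsilon),a,(q',\alpha_1,\dots,\alpha_n))$ with $\gamma\in\Gamma$, $\alpha_1\in\Gamma^*$, $\alpha_j\in(\Gamma\setminus\{\bot\})\cup\{\epsilon\}$ for $j\ge2$, or (b) a transition popping $\gamma\in\Gamma\setminus\{\bot\}$ from stack $i\in[2,n]$ (stacks $1..i-1$ read $\bot$, the rest $\epsilon$) and producing $\gamma'\bot$ on stack 1 ($\gamma'\in\Gamma\setminus\{\bot\}$), $\bot$ on stacks $2..i-1$, $\epsilon$ on stacks $i..n$. The paper assumes throughout that all OMPAs are in normal form. An $\mathcal{M}$-automaton is a finite state automaton $\mathcal{A}=(Q_{\mathcal{A}},\Gamma,\Delta_{\mathcal{A}},I_{\mathcal{A}},F_{\mathcal{A}})$ over $\Gamma$ with $I_{\mathcal{A}}=Q$; it accepts a configuration $(q,w_1,\dots,w_n)$ iff the word $w_1w_2\cdots w_n$ labels a path of $\mathcal{A}$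 from state $q$ to a state of $F_{\mathcal{A}}$; $L_{\mathcal{M}}(\mathcal{A})$ is the set of accepted configurations; $|\mathcal{A}|=|Q_{\mathcal{A}}|+|\Gamma|+|\Delta_{\mathcal{A}}|$. For a set $C$ of configurations, $\mathit{Pre}^*_{\mathcal{T}(\mathcal{M})}(C)$ is the set of configurations from which some configuration of $C$ is reachable by a finite (possibly empty) sequence of steps. *)

(* Defs.v *)
From Stdlib Require Export Relation_Operators.
From mathcomp Require Export all_boot.

Set Implicit Arguments.
Unset Strict Implicit.
Unset Printing Implicit Defensive.

(* ((q, g_1 .. g_n), a, (q', w_1 .. w_n)); [None] is the empty word, and
   [2.-bseq G] is the finite type of words over G of length at most 2. *)
Definition transition (n : nat) (Q S G : finType) : finType :=
  (Q * n.-tuple (option G) * option S * (Q * n.-tuple (2.-bseq G)))%type.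

Section Transition.
Variables (n : nat) (Q S G : finType).
Implicit Type t : transition n Q S G.

Definition source t : Q := t.1.1.1.
Definition pop t (i : 'I_n) : option G := tnth t.1.1.2 i.
Definition label t : option S := t.1.2.
Definition target t : Q := t.2.1.
Definition push t (i : 'I_n) : seq G := tnth t.2.2 i.

Definition wf_transition (bot : G) t : Prop :=
  forall i : 'I_n,
    (pop t i <> Some bot -> bot \notin push t i) /\
    (pop t i = Some bot ->
       exists u : seq G,
         [/\ size u <= 1, bot \notin u & push t i = rcons u bot]).

End Transition.

Record mpa (n : nat) (Q S G : finType) := Mpa {
  bot : G;
  delta : {set transition n Q S G};
  start : Q;
  start_symbol : G;
  final : {set Q};
  stacks_gt0 : 0 < n;
  start_symbol_neq_bot : start_symbol <> bot;
  delta_wf : forall t, t \in delta -> wf_transition bot t }.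

Section MPA.
Variables (n : nat) (Q S G : finType) (M : mpa n Q S G).

Definition mpa_size : nat := n + #|Q| + #|S| + #|G| + #|delta M|.

(* The stack contents, topmost symbol first. *)
Definition is_stack (w : seq G) : Prop :=
  exists2 u : seq G, bot M \notin u & w = rcons u (bot M).

(* Raw configurations; the configurations of M are those satisfying
   [is_config]. *)
Definition config : Type := (Q * n.-tuple (seq G))%type.

Definition is_config (c : config) : Prop :=
  forall i : 'I_n, is_stack (tnth c.2 i).

Definition step (c : config) (a : option S) (c' : config) : Prop :=
  exists (t : transition n Q S G) (w : n.-tuple (seq G)),
    [/\ t \in delta M,
        label t = a,
        forall i, is_stack (seq_of_opt (pop t i) ++ tnth w i),
        c = (source t, [tuple seq_of_opt (pop t i) ++ tnth w i | i < n]) &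
        c' = (target t, [tuple push t i ++ tnth w i | i < n])].

Definition reach : config -> config -> Prop :=
  clos_refl_trans config (fun c c' => exists a, step c a c').

Definition pre_star (C : config -> Prop) (c : config) : Prop :=
  is_config c /\ exists2 c', C c' & reach c c'.

Definition empty_config (q : Q) : config := (q, [tuple [:: bot M] | _ < n]).

(* Stacks are numbered from 0, not from 1. *)

Definition ordered : Prop :=
  forall t, t \in delta M ->
    exists i : 'I_n, forall j : 'I_n,
      (j < i -> pop t j = Some (bot M)) /\ (i < j -> pop t j = None).

Definition acts_on_first (t : transition n Q S G) : Prop :=
  forall j : 'I_n,
    if val j == 0 then pop t j <> None
    else [/\ pop t j = None, size (push t j) <= 1 & bot M \notin push t j].

Definition moves_to_first (t : transition n Q S G) : Prop :=
  exists (i : 'I_n) (g g' : G),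
    [/\ 0 < i, g <> bot M, g' <> bot M &
        forall j : 'I_n,
          pop t j = (if j < i then Some (bot M)
                     else if j == i then Some g else None) /\
          push t j = (if val j == 0 then [:: g'; bot M]
                      else if j < i then [:: bot M] else [::])].

Definition normal_form : Prop :=
  forall t, t \in delta M -> acts_on_first t \/ moves_to_first t.

End MPA.

(* A finite automaton over G whose initial states are exactly the states Q of
   the multi-pushdown automaton: its state set is Q extended by E. *)
Record m_automaton (Q G E : finType) := MAutomaton {
  aut_delta : {set (Q + E) * G * (Q + E)};
  aut_final : {set Q + E} }.

Section MAutomaton.
Variables (Q G E : finType) (A : m_automaton Q G E).

Definition aut_size : nat := #|{: Q + E}| + #|G| + #|aut_delta A|.

Fixpoint accepts_from (p : Q + E) (w : seq G) : Prop :=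
  if w is g :: w' then
    exists2 p', (p, g, p') \in aut_delta A & accepts_from p' w'
  else p \in aut_final A.

Definition aut_lang (n : nat) (S : finType) (M : mpa n Q S G)
    (c : config n Q G) : Prop :=
  is_config M c /\ accepts_from (inl c.1) (flatten c.2).

End MAutomaton.

(* The machine model is a first-order functional language over binary trees,
   with unit cost for each evaluation step (cf. Jones, Computability and
   Complexity). Values can be shared and every step takes constant time on
   pointers for a fixed program, so running times agree with those of random
   access or Turing machines up to a polynomial. *)

Inductive data : Type := Leaf | Node (x y : data).

Inductive exp : Type :=
  | Var (k : nat)                (* k-th entry of the environment *)
  | Nil
  | Cons (e1 e2 : exp)
  | Let (e1 e2 : exp)            (* e2 sees the value of e1 as variable 0 *)
  | Case (e e0 e1 : exp)         (* on Node x y, e1 sees x as 0 and y as 1 *)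
  | Call (f : nat) (es : seq exp).

(* The f-th entry is the body of function f, whose environment consists of its
   arguments. Function 0 is the entry point. *)
Definition program : Type := seq exp.

(* [eval P env e v t]: in the program P, e has value v in the environment env,
   computed in t steps. *)
Inductive eval (P : program) : seq data -> exp -> data -> nat -> Prop :=
  | EvalVar env k : eval P env (Var k) (nth Leaf env k) 1
  | EvalNil env : eval P env Nil Leaf 1
  | EvalCons env e1 e2 v1 v2 t1 t2 :
      eval P env e1 v1 t1 -> eval P env e2 v2 t2 ->
      eval P env (Cons e1 e2) (Node v1 v2) (t1 + t2).+1
  | EvalLet env e1 e2 v1 v2 t1 t2 :
      eval P env e1 v1 t1 -> eval P (v1 :: env) e2 v2 t2 ->
      eval P env (Let e1 e2) v2 (t1 + t2).+1
  | EvalCaseLeaf env e e0 e1 v t t' :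
      eval P env e Leaf t -> eval P env e0 v t' ->
      eval P env (Case e e0 e1) v (t + t').+1
  | EvalCaseNode env e e0 e1 x y v t t' :
      eval P env e (Node x y) t -> eval P (x :: y :: env) e1 v t' ->
      eval P env (Case e e0 e1) v (t + t').+1
  | EvalCall env f es vs v t t' :
      evals P env es vs t -> eval P vs (nth Nil P f) v t' ->
      eval P env (Call f es) v (t + t').+1
with evals (P : program) :
    seq data -> seq exp -> seq data -> nat -> Prop :=
  | EvalsNil env : evals P env [::] [::] 0
  | EvalsCons env e es v vs t t' :
      eval P env e v t -> evals P env es vs t' ->
      evals P env (e :: es) (v :: vs) (t + t').

Definition computes (P : program) (input output : data) (t : nat) : Prop :=
  eval P [:: input] (nth Nil P 0) output t.

(* Numbers are written in unary; this is harmless since the sizes of automata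
   count the elements of their state sets and alphabets. *)

Definition code_nat (k : nat) : data := iter k (Node Leaf) Leaf.

Definition code_elt (T : finType) (x : T) : data := code_nat (enum_rank x).

Definition code_seq (T : Type) (code : T -> data) (s : seq T) : data :=
  foldr (fun x => Node (code x)) Leaf s.

Definition code_option (T : Type) (code : T -> data) (o : option T) : data :=
  code_seq code (seq_of_opt o).

Definition code_set (T : finType) (code : T -> data) (A : {set T}) : data :=
  code_seq code (enum A).

Definition code_record : seq data -> data := code_seq id.

Definition code_transition (n : nat) (Q S G : finType)
    (t : transition n Q S G) : data :=
  code_record
    [:: code_elt (source t);
        code_seq (code_option (@code_elt G)) [seq pop t i | i <- enum 'I_n];
        code_option (@code_elt S) (label t);
        code_elt (target t);
        code_seq (code_seq (@code_elt G)) [seq push t i | i <- enum 'I_n]].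

Definition code_mpa (n : nat) (Q S G : finType) (M : mpa n Q S G) : data :=
  code_record
    [:: code_nat n; code_nat #|Q|; code_nat #|S|; code_nat #|G|;
        code_elt (bot M);
        code_set (@code_transition n Q S G) (delta M);
        code_elt (start M);
        code_elt (start_symbol M);
        code_set (@code_elt Q) (final M)].

Definition code_input (n : nat) (Q S G : finType) (M : mpa n Q S G) (q : Q) :
    data :=
  code_record [:: code_mpa M; code_elt q].

Definition code_automaton (Q G E : finType) (A : m_automaton Q G E) : data :=
  code_record
    [:: code_nat #|{: Q + E}|;
        code_nat #|G|;
        code_set (fun t : (Q + E) * G * (Q + E) =>
                    code_record [:: code_elt t.1.1; code_elt t.1.2;
                                    code_elt t.2])
                 (aut_delta A);
        (* the initial state of A corresponding to each state in Q, in order *)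
        code_seq (fun q : Q => code_elt (inl q : Q + E)) (enum Q);
        code_set (@code_elt (Q + E)%type) (aut_final A)].

(* Main.v *)
From Stdlib Require Import Operators_Properties.
From HB Require Import structures.
From mathcomp Require Import zify.
Require Import Defs.

(* A stack can only be popped when the earlier ones are empty. So one reads the
   stacks one after the other, each time from a state which predicts, for every
   later stack, the state from which its content will have to be read. Pushing
   a word on a later stack replaces the prediction s by some s' from which this
   word leads to s; when the current stack becomes empty, the current state has
   to agree with the prediction. There are |Q|^(2^i) states for the stack with
   i stacks after it, hence at most |M|^(2^n) states for each stack.
   The edges (x, g, y) between these states (reading g leads from x to y) are a
   least fixpoint, as in the usual saturation of a pushdown system: a transition
   popping g is matched with paths reading the words that it pushes. A
   configuration is in Pre* iff all its stacks can be read from a common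
   prediction. One direction is an induction along the run. For the other, a
   configuration whose stacks are read makes a step to another one, and the
   total size of the derivations of the edges that are read decreases.
   The program computes the fixpoint by iterating over the list of all
   candidate edges. It is written in a language where recursion is a fold over
   a list; a bound on the lengths of all lists bounds the running time of the
   compiled program by a polynomial. *)

Set Implicit Arguments.
Unset Strict Implicit.
Unset Printing Implicit Defensive.

(** * A language of folds and its compilation *)

(** The obstacle is that the automaton reads the stacks one after the other, whereas a run
    interleaves them: while a stack is being emptied, words are pushed on stacks whose content comes
    later in the input. The effect on a later stack is therefore recorded backwards, as the state
    from which its content at a given moment can be read. Since all later stacks may change while a
    stack is being emptied, the state of a stack has to carry complete states for them; so each
    level is the square of the one below, which is the source of the double exponent. Put N =
    |M|^(2^n). All loops and all data have size polynomial in N, and N^c is at most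
    |M|^(2^((c+1)n)), so a polynomial overhead only affects the constant d. This permits crude
    bounds everywhere. Two things have to be exact: a single program serves all automata, so even
    the levels are built at run time from n; and its output is literally the code of the automaton,
    including the order of its states and edges. *)

Fixpoint data_eqb (x y : data) : bool :=
  match x, y with
  | Leaf, Leaf => true
  | Node x1 x2, Node y1 y2 => data_eqb x1 y1 && data_eqb x2 y2
  | _, _ => false
  end.

Lemma data_eqP : Equality.axiom data_eqb.
Proof.
elim=> [|x1 IH1 x2 IH2] [|y1 y2]; try by constructor.
apply: (iffP andP) => [[/IH1 -> /IH2 ->] //|[<- <-]].
by split; [apply/IH1 | apply/IH2].
Qed.

HB.instance Definition _ := hasDecEq.Build data data_eqP.

Definition dfst (d : data) : data := if d is Node x _ then x else Leaf.
Definition dsnd (d : data) : data := if d is Node _ y then y else Leaf.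

Fixpoint dsize (d : data) : nat :=
  if d is Node x y then (dsize x + dsize y).+1 else 1.

Fixpoint unlist (d : data) : seq data :=
  if d is Node x l then x :: unlist l else [::].

Fixpoint para (F : data -> data -> data -> data) (i d : data) : data :=
  if d is Node x l then F (para F i l) x l else i.

Definition dbool (b : bool) : data := if b then Node Leaf Leaf else Leaf.

Fixpoint zipd (x y : data) : data :=
  match x, y with
  | Node a x', Node b y' => Node (Node a b) (zipd x' y')
  | _, _ => Leaf
  end.

Inductive op := OpEq | OpZip | OpAnd | OpOr.

Definition den_op (o : op) (x y : data) : data :=
  match o with
  | OpEq => dbool (x == y)
  | OpZip => zipd x y
  | OpAnd => if x is Node _ _ then y else Leaf
  | OpOr => if x is Node _ _ then x else y
  end.

Definition op_size (o : op) (x : data) : nat :=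
  match o with OpEq | OpZip => dsize x | OpAnd | OpOr => 0 end.

(* [V], [N0], [C], [Lt] and [Cs] stand for [Var], [Nil], [Cons], [Let] and
   [Case]. Recursion is confined to [Fold]: its body sees, in this order, the result
   for the tail, the head and the tail of the list. *)
Inductive lang : Type :=
  | V (k : nat)
  | N0
  | C (a b : lang)
  | Lt (a b : lang)
  | Cs (a b c : lang)
  | Op (o : op) (a b : lang)
  | Fold (l i b : lang).

Fixpoint den (env : seq data) (e : lang) : data :=
  match e with
  | V k => nth Leaf env k
  | N0 => Leaf
  | C a b => Node (den env a) (den env b)
  | Lt a b => den (den env a :: env) b
  | Cs a b c => if den env a is Node x y then den (x :: y :: env) c
                else den env b
  | Op o a b => den_op o (den env a) (den env b)
  | Fold l i b =>
      para (fun acc x tl => den (acc :: x :: tl :: env) b)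
           (den env i) (den env l)
  end.

Definition eq_body : exp :=
  Case (Var 0) (Case (Var 1) (Cons Nil Nil) Nil)
    (Case (Var 3) Nil
      (Case (Call 1 [:: Var 2; Var 0]) Nil (Call 1 [:: Var 5; Var 3]))).

Definition zip_body : exp :=
  Case (Var 0) Nil
    (Case (Var 3) Nil
      (Cons (Cons (Var 2) (Var 0)) (Call 2 [:: Var 3; Var 1]))).

Definition and_body : exp := Case (Var 0) Nil (Var 3).
Definition or_body : exp := Case (Var 0) (Var 1) (Var 2).

Definition op_index (o : op) : nat :=
  match o with OpEq => 1 | OpZip => 2 | OpAnd => 3 | OpOr => 4 end.

(* [comp m f e] compiles [e] for environments of length at least [m], and puts
   the loops of [e] into functions numbered from [f] on. A loop receives the
   current environment followed by the list that remains to be processed. *)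
Fixpoint comp (m f : nat) (e : lang) : exp * seq exp :=
  match e with
  | V k => (if k < m then Var k else Nil, [::])
  | N0 => (Nil, [::])
  | C a b =>
      let ca := comp m f a in
      let cb := comp m (f + size ca.2) b in
      (Cons ca.1 cb.1, ca.2 ++ cb.2)
  | Lt a b =>
      let ca := comp m f a in
      let cb := comp m.+1 (f + size ca.2) b in
      (Let ca.1 cb.1, ca.2 ++ cb.2)
  | Cs a b c =>
      let ca := comp m f a in
      let cb := comp m (f + size ca.2) b in
      let cc := comp m.+2 (f + size ca.2 + size cb.2) c in
      (Case ca.1 cb.1 cc.1, ca.2 ++ (cb.2 ++ cc.2))
  | Op o a b =>
      let ca := comp m f a in
      let cb := comp m (f + size ca.2) b in
      (Call (op_index o) [:: ca.1; cb.1], ca.2 ++ cb.2)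
  | Fold l i b =>
      let cl := comp m f.+1 l in
      let ci := comp m (f.+1 + size cl.2) i in
      let cb := comp m.+3 (f.+1 + size cl.2 + size ci.2) b in
      (Call f (map Var (iota 0 m) ++ [:: cl.1]),
       Case (Var m) ci.1
         (Let (Call f (map Var (iota 2 m) ++ [:: Var 1])) cb.1)
         :: (cl.2 ++ (ci.2 ++ cb.2)))
  end.

(** Functions 1 to 4 are the operators in the numbering of [op_index], so loops are numbered from 5;
    the environment of the entry point is the input alone. *)
Definition compile (e : lang) : program :=
  let c := comp 1 5 e in
  [:: c.1; eq_body; zip_body; and_body; or_body] ++ c.2.

(* All loops run over lists of length at most B, and all arguments of equality
   tests and of zips have size at most B. *)
Fixpoint ok (B : nat) (env : seq data) (e : lang) : Prop :=
  match e with
  | V _ | N0 => True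
  | C a b => ok B env a /\ ok B env b
  | Lt a b => ok B env a /\ ok B (den env a :: env) b
  | Cs a b c => ok B env a /\ if den env a is Node x y then ok B (x :: y :: env) c
                              else ok B env b
  | Op o a b => [/\ ok B env a, ok B env b & op_size o (den env a) <= B]
  | Fold l i b =>
      [/\ ok B env l, ok B env i, size (unlist (den env l)) <= B &
       (fix okp (d : data) : Prop :=
          if d is Node x tl then
            okp tl /\
            ok B (para (fun acc x tl => den (acc :: x :: tl :: env) b)
                       (den env i) tl :: x :: tl :: env) b
          else True) (den env l)]
  end.

(** A running time independent of the data. The length [m] of the environment enters because a loop
    hands over its whole environment in each iteration; [20 * B] pays for an equality test or a
    zip. *)
Fixpoint weight (B m : nat) (e : lang) : nat :=
  match e with
  | V _ | N0 => 1
  | C a b => (weight B m a + weight B m b).+1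
  | Lt a b => (weight B m a + weight B m.+1 b).+1
  | Cs a b c => (weight B m a + weight B m b + weight B m.+2 c).+1
  | Op _ a b => weight B m a + weight B m b + 20 * B + 9
  | Fold l i b =>
      weight B m l + weight B m i + m + 9 + B * (weight B m.+3 b + m + 9)
  end.

Lemma leq_scaled K a x T : a <= K * x -> x <= T -> a <= K * T.
Proof. by move=> h l; apply: leq_trans h (leq_mul (leqnn K) l). Qed.

(** The nesting of loops is fixed by the term, so the degree is a constant. Adding the exponents of
    the subterms is wasteful but sufficient. *)
Lemma weight_poly (m : nat) (e : lang) :
  exists K d, forall B, 0 < B -> weight B m e <= K * B ^ d.
Proof.
have leD (B d d' : nat) : 0 < B -> d <= d' -> B ^ d <= B ^ d'.
  by move=> B0; apply: leq_pexp2l.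
elim: e m => [k||a IHa b IHb|a IHa b IHb|a IHa b IHb c IHc|o a IHa b IHb
             |l IHl i IHi b IHb] m /=.
- by exists 1, 0 => B; rewrite expn0.
- by exists 1, 0 => B; rewrite expn0.
- have [K [d H]] := IHa m; have [K' [d' H']] := IHb m.
  exists (K + K' + 1), (d + d') => B B0.
  have := leq_scaled (H B B0) (leD _ _ _ B0 (leq_addr d' d)).
  have := leq_scaled (H' B B0) (leD _ _ _ B0 (leq_addl d d')).
  have : 0 < B ^ (d + d') by rewrite expn_gt0 B0.
  by rewrite !mulnDl mul1n; lia.
- have [K [d H]] := IHa m; have [K' [d' H']] := IHb m.+1.
  exists (K + K' + 1), (d + d') => B B0.
  have := leq_scaled (H B B0) (leD _ _ _ B0 (leq_addr d' d)).
  have := leq_scaled (H' B B0) (leD _ _ _ B0 (leq_addl d d')).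
  have : 0 < B ^ (d + d') by rewrite expn_gt0 B0.
  by rewrite !mulnDl mul1n; lia.
- have [K [d H]] := IHa m; have [K' [d' H']] := IHb m.
  have [K'' [d'' H'']] := IHc m.+2.
  exists (K + K' + K'' + 1), (d + d' + d'') => B B0.
  have : d <= d + d' + d'' by lia.
  move=> /(leD _ _ _ B0)/(leq_scaled (H B B0)).
  have : d' <= d + d' + d'' by lia.
  move=> /(leD _ _ _ B0)/(leq_scaled (H' B B0)).
  have : d'' <= d + d' + d'' by lia.
  move=> /(leD _ _ _ B0)/(leq_scaled (H'' B B0)).
  have : 0 < B ^ (d + d' + d'') by rewrite expn_gt0 B0.
  by rewrite !mulnDl mul1n; lia.
- have [K [d H]] := IHa m; have [K' [d' H']] := IHb m.
  exists (K + K' + 29), (d + d' + 1) => B B0.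
  have : d <= d + d' + 1 by lia.
  move=> /(leD _ _ _ B0)/(leq_scaled (H B B0)).
  have : d' <= d + d' + 1 by lia.
  move=> /(leD _ _ _ B0)/(leq_scaled (H' B B0)).
  have : 1 <= d + d' + 1 by lia.
  move=> /(leD _ _ _ B0); rewrite expn1.
  by rewrite !mulnDl; lia.
- have [K [d H]] := IHl m; have [K' [d' H']] := IHi m.
  have [K'' [d'' H'']] := IHb m.+3.
  exists (K + K' + K'' + (m + 9) + (m + 9)), (d + d' + d'' + 1) => B B0.
  have : d <= d + d' + d'' + 1 by lia.
  move=> /(leD _ _ _ B0)/(leq_scaled (H B B0)).
  have : d' <= d + d' + d'' + 1 by lia.
  move=> /(leD _ _ _ B0)/(leq_scaled (H' B B0)).
  have : d''.+1 <= d + d' + d'' + 1 by lia.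
  move=> /(leD _ _ _ B0); rewrite expnS => h.
  have := leq_mul (leqnn B) (H'' B B0); rewrite mulnCA => /leq_scaled/(_ h).
  have : 1 <= d + d' + d'' + 1 by lia.
  move=> /(leD _ _ _ B0); rewrite expn1 => h1.
  have := leq_mul (leqnn (m + 9)) h1.
  rewrite !mulnDl !mulnDr; nia.
Qed.

(** * Correctness and cost of compiled terms *)

Definition code_at (P : program) (f : nat) (ps : seq exp) : Prop :=
  forall i, i < size ps -> nth Nil P (f + i) = nth Nil ps i.

Lemma code_at_cat P f ps ps' :
  code_at P f (ps ++ ps') -> code_at P f ps /\ code_at P (f + size ps) ps'.
Proof.
move=> H; split=> i Hi.
  by rewrite H ?size_cat ?nth_cat ?Hi // ltn_addr.
by rewrite -addnA H ?size_cat ?ltn_add2l // nth_cat ltnNge leq_addr /= addKn.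
Qed.

Lemma code_at_cons P f b ps :
  code_at P f (b :: ps) -> nth Nil P f = b /\ code_at P f.+1 ps.
Proof.
move=> H; split; first by have := H 0 (ltn0Sn _); rewrite addn0.
by move=> i Hi; rewrite addSnnS H.
Qed.

(** The calls of loops pass the environment on, variable by variable. [pre] is empty when a loop is
    entered, and consists of the head and the tail of the list when it calls itself. *)
Lemma evals_vars P pre env tl es vs t :
  evals P (pre ++ env ++ tl) es vs t ->
  evals P (pre ++ env ++ tl) (map Var (iota (size pre) (size env)) ++ es)
    (env ++ vs) (size env + t).
Proof.
elim: env pre => [|x env IH] pre //= H.
rewrite -cat_rcons in H; move/IH: H; rewrite size_rcons cat_rcons addSn -add1n.
apply: (@EvalsCons _ _ (Var (size pre)) _ x _ 1); rewrite -{2}(_ :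
  nth Leaf (pre ++ x :: env ++ tl) (size pre) = x); first exact: EvalVar.
by rewrite nth_cat ltnn subnn.
Qed.

Section Compile.
Variables (P : program) (B : nat).
Hypotheses (Peq : nth Nil P 1 = eq_body) (Pzip : nth Nil P 2 = zip_body)
  (Pand : nth Nil P 3 = and_body) (Por : nth Nil P 4 = or_body).

Lemma dsize_gt0 d : 0 < dsize d. Proof. by case: d. Qed.

Lemma eval_var env k v : nth Leaf env k = v -> eval P env (Var k) v 1.
Proof. by move<-; exact: EvalVar. Qed.

(** Apart from the recursive calls, at most 11 steps are spent at a node; the factor 20 is
    generous. *)
Lemma eval_eq x y :
  exists2 t, t <= 20 * dsize x & eval P [:: x; y] eq_body (dbool (x == y)) t.
Proof.
elim: x y => [|x1 IH1 x2 IH2] y /=.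
  case: y => [|y1 y2] /=.
    exists 7 => //; apply: (@EvalCaseLeaf _ _ _ _ _ _ 1 5); first exact: eval_var.
    apply: (@EvalCaseLeaf _ _ _ _ _ _ 1 3); first exact: eval_var.
    by apply: (@EvalCons _ _ _ _ _ _ 1 1); constructor.
  exists 5 => //; apply: (@EvalCaseLeaf _ _ _ _ _ _ 1 3); first exact: eval_var.
  by apply: (@EvalCaseNode _ _ _ _ _ _ _ _ 1 1); [exact: eval_var | constructor].
case: y => [|y1 y2].
  exists 5; first lia.
  apply: (@EvalCaseNode _ _ _ _ _ _ _ _ 1 3); first exact: eval_var.
  by apply: (@EvalCaseLeaf _ _ _ _ _ _ 1 1); [exact: eval_var | constructor].
have -> : (Node x1 x2 == Node y1 y2) = (x1 == y1) && (x2 == y2) by [].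
have [t1 l1 e1] := IH1 y1; have [t2 l2 e2] := IH2 y2.
have c1 : eval P [:: y1, y2, x1, x2, Node x1 x2 & [:: Node y1 y2]]
   (Call 1 [:: Var 2; Var 0]) (dbool (x1 == y1)) (2 + t1).+1.
  apply: (@EvalCall _ _ _ _ [:: x1; y1]); last by rewrite Peq.
  by apply: (@EvalsCons _ _ _ _ _ _ 1 1);
    [exact: eval_var | apply: (@EvalsCons _ _ _ _ _ _ 1 0);
      [exact: eval_var | constructor]].
move: c1; case: (x1 == y1) => /= c1.
  exists (11 + t1 + t2); first lia.
  rewrite (_ : 11 + _ + _ = (1 + (1 + ((2 + t1).+1 + (2 + t2).+1).+1).+1).+1); last lia.
  apply: EvalCaseNode; first exact: eval_var.
  apply: EvalCaseNode; first exact: eval_var.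
  apply: EvalCaseNode; first exact: c1.
  apply: (@EvalCall _ _ _ _ [:: x2; y2]); last by rewrite Peq.
  by apply: (@EvalsCons _ _ _ _ _ _ 1 1);
    [exact: eval_var | apply: (@EvalsCons _ _ _ _ _ _ 1 0);
      [exact: eval_var | constructor]].
exists (9 + t1); first by have := dsize_gt0 x2; lia.
rewrite (_ : 9 + _ = (1 + (1 + ((2 + t1).+1 + 1).+1).+1).+1); last lia.
apply: EvalCaseNode; first exact: eval_var.
apply: EvalCaseNode; first exact: eval_var.
by apply: EvalCaseLeaf; [exact: c1 | constructor].
Qed.

Lemma eval_zip x y :
  exists2 t, t <= 20 * dsize x & eval P [:: x; y] zip_body (zipd x y) t.
Proof.
elim: x y => [|x1 _ x2 IH] y /=.
  by exists 3 => //; apply: (@EvalCaseLeaf _ _ _ _ _ _ 1 1); [exact: eval_var | constructor].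
case: y => [|y1 y2].
  exists 5; first lia.
  apply: (@EvalCaseNode _ _ _ _ _ _ _ _ 1 3); first exact: eval_var.
  by apply: (@EvalCaseLeaf _ _ _ _ _ _ 1 1); [exact: eval_var | constructor].
have [t l e] := IH y2.
exists (11 + t); first lia.
rewrite (_ : 11 + _ = (1 + (1 + (3 + (2 + t).+1).+1).+1).+1); last lia.
apply: EvalCaseNode; first exact: eval_var.
apply: EvalCaseNode; first exact: eval_var.
apply: EvalCons; first by apply: (@EvalCons _ _ _ _ _ _ 1 1); exact: eval_var.
apply: (@EvalCall _ _ _ _ [:: x2; y2]); last by rewrite Pzip.
by apply: (@EvalsCons _ _ _ _ _ _ 1 1);
  [exact: eval_var | apply: (@EvalsCons _ _ _ _ _ _ 1 0);
    [exact: eval_var | constructor]].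
Qed.

Lemma eval_op o x y :
  exists2 t, t <= 20 * op_size o x + 3 &
    eval P [:: x; y] (nth Nil P (op_index o)) (den_op o x y) t.
Proof.
case: o => /=; rewrite ?Peq ?Pzip ?Pand ?Por.
- by have [t l e] := eval_eq x y; exists t => //; lia.
- by have [t l e] := eval_zip x y; exists t => //; lia.
- case: x => [|x1 x2]; exists 3; rewrite /=; try lia.
    by apply: (@EvalCaseLeaf _ _ _ _ _ _ 1 1); [exact: eval_var | constructor].
  by apply: (@EvalCaseNode _ _ _ _ _ _ _ _ 1 1); exact: eval_var.
- case: x => [|x1 x2]; exists 3; rewrite /=; try lia.
    by apply: (@EvalCaseLeaf _ _ _ _ _ _ 1 1); exact: eval_var.
  by apply: (@EvalCaseNode _ _ _ _ _ _ _ _ 1 1); exact: eval_var.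
Qed.

(** [tl] stands for the list argument that a loop keeps behind its environment. It has to be
    invisible to the source term, which is why [comp] turns variables from [m] on into [Nil]. *)
Lemma comp_correct e env tl f :
  let c := comp (size env) f e in
  code_at P f c.2 -> ok B env e ->
  exists2 t, t <= weight B (size env) e & eval P (env ++ tl) c.1 (den env e) t.
Proof.
elim: e env tl f => [k||a IHa b IHb|a IHa b IHb|a IHa b IHb c IHc|o a IHa b IHb
             |l IHl i IHi b IHb] env tl f /=.
- move=> _ _; exists 1 => //; case: ltnP => Hk.
    by apply: eval_var; rewrite nth_cat Hk.
  by rewrite nth_default //; constructor.
- by exists 1 => //; constructor.
- move=> /code_at_cat[pa pb] [oa ob].
  have [ta la ea] := IHa _ tl _ pa oa; have [tb lb eb] := IHb _ tl _ pb ob.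
  by exists (ta + tb).+1; [lia | apply: EvalCons].
- move=> /code_at_cat[pa pb] [oa ob].
  have [ta la ea] := IHa _ tl _ pa oa; have [tb lb eb] := IHb (_ :: _) tl _ pb ob.
  by exists (ta + tb).+1; [move: lb => /=; lia | apply: EvalLet ea eb].
- move=> /code_at_cat[pa /code_at_cat[pb pc]] [oa].
  have [ta la ea] := IHa _ tl _ pa oa.
  case: (den env a) ea => [|x y] ea ob.
    have [tb lb eb] := IHb _ tl _ pb ob.
    by exists (ta + tb).+1; [lia | apply: EvalCaseLeaf].
  have [tc lc ec] := IHc [:: x, y & env] tl _ pc ob.
  by exists (ta + tc).+1; [move: lc => /=; lia | apply: EvalCaseNode ea ec].
- move=> /code_at_cat[pa pb] [oa ob oB].
  have [ta la ea] := IHa _ tl _ pa oa; have [tb lb eb] := IHb _ tl _ pb ob.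
  have [t lt et] := eval_op o (den env a) (den env b).
  exists (ta + (tb + 0) + t).+1; first nia.
  apply: EvalCall et; apply: EvalsCons => //; apply: EvalsCons => //; constructor.
move=> /code_at_cons[Pf /code_at_cat[pl /code_at_cat[pi pb]]] [ol oi oB].
have [t lt et] := IHl _ tl _ pl ol.
set F := fun acc x tl => _.
move: (den env l) oB et => d dB et od.
(* The loop function itself, run on an arbitrary list: each element costs its body and one call,
   which copies the environment. *)
suff [t' lt' et'] : exists2 t', t' <= 2 + weight B (size env) i +
     size (unlist d) * (weight B (size env).+3 b + size env + 9) &
   eval P (env ++ [:: d]) (nth Nil P f) (para F (den env i) d) t'.
  exists (size env + (t + 0) + t').+1; first by nia.
  apply: EvalCall et'; apply: (@evals_vars P [::] env tl).
  by apply: EvalsCons => //; constructor.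
elim: d {dB et} od => [|x _ d IHd] /= [].
  have [ti li ei] := IHi _ [:: Leaf] _ pi oi.
  exists (1 + ti).+1; first lia.
  rewrite Pf; apply: EvalCaseLeaf; last exact: ei.
  by apply: eval_var; rewrite nth_cat ltnn subnn.
move=> /IHd[t1 l1 e1] /(IHb [:: _, x, d & env] [:: Node x d] _ pb)[t2 /= l2 e2].
exists (1 + ((size env + (1 + 0) + t1).+1 + t2).+1).+1; first nia.
rewrite [in X in eval _ _ X]Pf; apply: (@EvalCaseNode _ _ _ _ _ x d).
  by apply: eval_var; rewrite nth_cat ltnn subnn.
apply: EvalLet e2; apply: EvalCall e1.
apply: (@evals_vars P [:: x; d] env).
by apply: EvalsCons; [exact: eval_var | constructor].
Qed.

End Compile.

Lemma compile_correct (B : nat) (e : lang) (d : data) :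
  ok B [:: d] e ->
  exists2 t, t <= weight B 1 e & computes (compile e) d (den [:: d] e) t.
Proof.
move=> oe; have := @comp_correct (compile e) B erefl erefl erefl erefl e [:: d] [::] 5.
by apply=> // i _.
Qed.

(** * Predictions and saturation *)

Notation dlist := (code_seq (@id data)).

Lemma unlistK d : dlist (unlist d) = d.
Proof. by elim: d => //= x _ l ->. Qed.

Lemma dlistK l : unlist (dlist l) = l.
Proof. by elim: l => //= x l ->. Qed.

Lemma dlist_inj : injective (dlist).
Proof. exact: can_inj dlistK. Qed.

Lemma code_nat_inj : injective code_nat.
Proof. by elim=> [|i IH] [|j] //= [/IH ->]. Qed.

Lemma code_elt_inj (T : finType) : injective (@code_elt T).
Proof. by move=> x y /code_nat_inj /val_inj /enum_rank_inj. Qed.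

Section Predictions.
Variables (n : nat) (Q S G : finType) (M : mpa n Q S G) (q : Q).
Notation bot := (bot M).

Definition mk (p : Q) (l : seq data) : data := Node (code_elt p) (dlist l).

Lemma mk_inj p p' l l' : mk p l = mk p' l' -> p = p' /\ l = l'.
Proof. by case=> /code_elt_inj -> /dlist_inj ->. Qed.

Definition extend (L : seq data) : seq data :=
  [seq Node (dfst v) (Node x (dsnd v)) | x <- L, v <- L].

(* The states of level i, for the (n - i)-th stack: the current control state p,
   together with one state of level i - 1, ..., 0 for each of the later stacks,
   from which the content of that stack will have to be read once the stacks
   before it are empty. *)
Definition level (i : nat) : seq data :=
  iter i extend [seq mk p [::] | p <- enum Q].

(* The states from which stacks 1, ..., n have to be read. *)
Definition preds (X : data) : seq data := X :: unlist (dsnd X).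

Lemma levelS i x p l :
  x \in level i -> mk p l \in level i -> mk p (x :: l) \in level i.+1.
Proof. by move=> xi li; apply/allpairsP; exists (x, mk p l). Qed.

Lemma level_inv i x : x \in level i ->
  exists p l, [/\ x = mk p l, size l = i &
    forall j, j < i -> nth Leaf l j \in level (i - j).-1].
Proof.
elim: i x => [|i IH] x.
  by case/mapP=> p _ ->; exists p, [::].
case/allpairsP=> -[y v] /= [yi /IH[p [l [-> sl Hl]]] ->].
exists p, (y :: l); split => //=; first by rewrite sl.
by case=> [|j] //= ji; rewrite subSS; apply: Hl.
Qed.

Lemma level_intro i p l : size l = i ->
  (forall j, j < i -> nth Leaf l j \in level (i - j).-1) -> mk p l \in level i.
Proof.
elim: i l => [|i IH] [|y l] //=.
  by move=> _ _; apply: map_f; rewrite mem_enum.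
case=> sl H; apply: levelS; first by apply: (H 0).
by apply: IH => // j ji; apply: (H j.+1).
Qed.

Lemma nth_preds i X j : X \in level i -> j <= i ->
  nth Leaf (preds X) j \in level (i - j).
Proof.
case: j => [|j] Xi ji; first by rewrite subn0.
have [p [l [-> _ H]]] := level_inv Xi.
by rewrite /= dlistK subnS; apply: H.
Qed.

(** The state of an earlier stack that agrees with the state [x] predicted for the next one: same
    control state, same remaining predictions. Such states may read [bot]. *)
Definition dup (x : data) : data := Node (dfst x) (Node x (dsnd x)).

Lemma level_dup i k x : x \in level i -> iter k dup x \in level (k + i).
Proof.
move=> xi; elim: k => [|k IH] //=.
by have [p [l [E _ _]]] := level_inv IH; rewrite {1}E /= -/(mk _ _); apply: levelS; rewrite -?E.
Qed.

(** This is the prediction for a configuration whose first k stacks contain only [bot], stack k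
    being read from [x]. *)
Lemma nth_preds_dup k x j : nth Leaf (preds (iter k dup x)) j =
  if j < k then iter (k - j) dup x else nth Leaf (preds x) (j - k).
Proof.
elim: k j => [|k IH] j; first by rewrite subn0.
by case: j => [|j] //; rewrite subSS ltnS -IH.
Qed.

Lemma dfst_iter_dup k x : dfst (iter k dup x) = dfst x.
Proof. by elim: k. Qed.

Lemma preds_cons_dup p l : dup (mk p l) = mk p (mk p l :: l).
Proof. by []. Qed.

(* [Leaf] is the state reached when a stack has been read entirely. *)
Definition base (x : data) (g : G) (y : data) : Prop :=
  [/\ g = bot, y = Leaf & (exists p l, x = dup (mk p l)) \/ x = mk q [::]].

(* What a transition responsible for an edge (x, g, y) has to satisfy, where x
   has predictions l and belongs to stack k: the symbol that it pops from each
   stack, and the state in which the word that it pushes on this stack has to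
   be read. An earlier stack is read entirely, stack k leads to y, and a later
   stack leads to the prediction of x, which concerns what lies beneath. *)
Definition targets (k : nat) (g : G) (y : data) (l : seq data) :
    seq (option G * data) :=
  nseq k (Some bot, Leaf) ++ (Some g, y) :: [seq (None, s) | s <- l].

Definition target_of (g : G) (y : data) (l : seq data) (j : nat) :=
  nth (None, Leaf) (targets (n.-1 - size l) g y l) j.

Section Path.
Variable R : data -> G -> data -> Prop.

Fixpoint path_on (s : data) (w : seq G) (z : data) : Prop :=
  if w is a :: w' then exists2 m, R s a m & path_on m w' z else s = z.

Lemma path_on_cat s w w' z : path_on s (w ++ w') z <->
  exists2 m, path_on s w m & path_on m w' z.
Proof.
elim: w s => [|a w IH] s /=; first by split=> [|[m ->]] //; exists s.
split=> [[m sm /IH[m' mm' H]]|[m [m' sm' m'm] H]].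
  by exists m' => //; exists m.
by exists m' => //; apply/IH; exists m.
Qed.

(** [X] guesses the states from which all stacks are read after [t]. It is related to [x] and [y]
    only through the pushed words. *)
Definition rule (x : data) (g : G) (y : data) : Prop :=
  exists t X l,
    [/\ t \in delta M, X \in level n.-1, dfst X = code_elt (target t),
        x = mk (source t) l &
        forall j : 'I_n, pop t j = (target_of g y l j).1 /\
          path_on (nth Leaf (preds X) j) (push t j) (target_of g y l j).2].

Definition accepts_preds (X : data) (c : config n Q G) : Prop :=
  forall j : 'I_n, path_on (nth Leaf (preds X) j) (tnth c.2 j) Leaf.

End Path.

(* Derivations with their sizes, which soundness decreases along a run. *)
Inductive der : nat -> data -> G -> data -> Prop :=
  | DerBase x g y : base x g y -> der 1 x g y
  | DerRule t X l g y (f : 'I_n -> nat) :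
      t \in delta M -> X \in level n.-1 -> dfst X = code_elt (target t) ->
      (forall j : 'I_n, pop t j = (target_of g y l j).1) ->
      (forall j : 'I_n, pathd (f j) (nth Leaf (preds X) j) (push t j)
                               (target_of g y l j).2) ->
      der (\sum_j f j).+1 (mk (source t) l) g y
with pathd : nat -> data -> seq G -> data -> Prop :=
  | PathNil s : pathd 0 s [::] s
  | PathCons m m' s a z w z' :
      der m s a z -> pathd m' z w z' -> pathd (m + m') s (a :: w) z'.

Lemma pathd_cat m m' s w z w' z' :
  pathd m s w z -> pathd m' z w' z' -> pathd (m + m') s (w ++ w') z'.
Proof.
elim: w m s => [|a w IH] m s H; first by inversion H; subst.
by inversion H; subst => H'; rewrite -addnA; apply: PathCons; eauto.
Qed.

Lemma pathd_path_on (R : data -> G -> data -> Prop) s w z :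
  (forall x g y, R x g y -> exists m, der m x g y) ->
  path_on R s w z -> exists m, pathd m s w z.
Proof.
move=> RD; elim: w s => [|a w IH] s /=; first by move->; exists 0; constructor.
by case=> m /RD[k d] /IH[k' d']; exists (k + k'); apply: PathCons; eauto.
Qed.

Lemma stack_bot w : is_stack M (bot :: w) -> w = [::].
Proof. by case=> -[|a u] ub [] // E Hw; move: ub; rewrite -E inE eqxx. Qed.

Lemma stack_behead g w : is_stack M (g :: w) -> g <> bot -> is_stack M w.
Proof.
case=> -[|a u] ub [] -> -> // _.
by exists u => //; move: ub; rewrite inE negb_or => /andP[].
Qed.

Lemma stack_cat u w : bot \notin u -> is_stack M w -> is_stack M (u ++ w).
Proof.
move=> ub [v vb ->]; exists (u ++ v); last by rewrite rcons_cat.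
by rewrite mem_cat negb_or ub.
Qed.

Lemma step_is_config c a c' : step M c a c' -> is_config M c'.
Proof.
case=> t [w [td _ Hw _ ->]] i; rewrite tnth_mktuple.
have [h1 h2] := delta_wf td i; have := Hw i.
case Ep: (pop t i) h1 h2 => [g|] h1 h2; last by apply: stack_cat; apply: h1.
case: (g =P bot) Ep h1 h2 => [->|gb] Ep h1 h2 /=.
  move=> /stack_bot ->; have [//|u [_ ub ->]] := h2.
  by rewrite cats0; exists u.
by move=> /stack_behead/(_ gb); apply: stack_cat; apply: h1; case.
Qed.

(** * Soundness: a configuration whose stacks are read reaches the target *)

Hypothesis n_gt0 : 0 < n.

Lemma target_of_lt g y l (j : nat) : j < n.-1 - size l ->
  target_of g y l j = (Some bot, Leaf).
Proof. by move=> H; rewrite /target_of nth_cat size_nseq H nth_nseq H. Qed.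

Lemma target_of_eq g y l :
  target_of g y l (n.-1 - size l) = (Some g, y).
Proof. by rewrite /target_of nth_cat size_nseq ltnn subnn. Qed.

Lemma target_of_gt g y l (j : nat) : n.-1 - size l < j -> size l < n ->
  j < n -> target_of g y l j = (None, nth Leaf l (j - (n - size l))).
Proof.
move=> H sl jn; rewrite /target_of nth_cat size_nseq ltnNge (ltnW H) /=.
rewrite (_ : j - (n.-1 - size l) = (j - (n - size l)).+1); last lia.
by rewrite /= (nth_map Leaf) //; lia.
Qed.

(** Each earlier state is a duplicate of the next one, so the control state [p] is handed down to
    stack k. The alternative [mk q [::]] is impossible before the last stack, whose state alone has
    no predictions. *)
Lemma preds_spine X p l k : X = mk p l -> size l = n.-1 ->
  (forall i, i < k ->
     (exists p' l', nth Leaf (preds X) i = dup (mk p' l')) \/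
     nth Leaf (preds X) i = mk q [::]) ->
  k < n -> nth Leaf (preds X) k = mk p (drop k l).
Proof.
move=> -> sl; elim: k => [|k IH] Hb kn; first by rewrite drop0.
have ek : nth Leaf (preds (mk p l)) k = mk p (drop k l).
  by apply: IH => [i ik|]; [apply: Hb | ]; lia.
have dk : drop k l = nth Leaf l k :: drop k.+1 l by apply: drop_nth; lia.
have := Hb k (ltnSn k); rewrite ek dk => -[[p' [l']]|/mk_inj[] //].
by rewrite preds_cons_dup /= dlistK => /mk_inj[<- [-> <-]].
Qed.

(** Let k be the first stack whose first edge does not come from [base]. All stacks before it are
    down to [bot], and by [preds_spine] it is read from the actual control state, so the transition
    behind its first edge can fire. This trades the edge for its premises, whose total size is
    smaller by one, while the contents below are read as before. *)
Lemma sound_sized N X c (f : 'I_n -> nat) :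
  \sum_j f j <= N -> X \in level n.-1 -> dfst X = code_elt c.1 ->
  is_config M c ->
  (forall j : 'I_n, pathd (f j) (nth Leaf (preds X) j) (tnth c.2 j) Leaf) ->
  reach M c (empty_config M q).
Proof.
elim: N X c f => [|N IH] X [p W] f fN Xl /= EX cW H.
  (* A stack is never empty and every edge has positive size, so the bound 0 is contradictory. *)
  have := H (Ordinal n_gt0); have := cW (Ordinal n_gt0) => /=.
  case: (tnth W _) => [[[|? ?]]//|a w] _ h; inversion h as [|? ? ? ? ? ? ? h1 h2 e1]; subst.
  have : m = 0.
    by move: fN; rewrite (bigD1 (Ordinal n_gt0)) //= -e1; lia.
  by move=> m0; inversion h1; subst.
have [p' [l [EXl sl _]]] := level_inv Xl.
have {p' EXl} EXl : X = mk p l by move: EX; rewrite EXl => -[/code_elt_inj ->].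
pose isbase (j : 'I_n) := tnth W j = [:: bot] /\
   ((exists p' l', nth Leaf (preds X) j = dup (mk p' l')) \/
     nth Leaf (preds X) j = mk q [::]).
pose nonbase (j : 'I_n) := exists a w y m m' t X' l' f',
  [/\ tnth W j = a :: w, pathd m' y w Leaf, f j = m.+1 + m',
      nth Leaf (preds X) j = mk (source t) l' &
  [/\ t \in delta M, X' \in level n.-1, dfst X' = code_elt (target t),
     m = \sum_j f' j &
     forall j : 'I_n, pop t j = (target_of a y l' j).1 /\
       pathd (f' j) (nth Leaf (preds X') j) (push t j) (target_of a y l' j).2]].
have dich j : isbase j \/ nonbase j.
  have := H j; have := cW j; rewrite /isbase /nonbase /=.
  case: (tnth W j) => [[[|? ?]]//|a w] st h.
  inversion h as [|m m' ? ? z ? ? h1 h2 e1]; subst.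
  inversion h1 as [? ? ? [E1 E2 E3]|t X' l' ? ? f' h3 h4 h5 h6 h7]; subst.
    by left; split=> //; move/stack_bot: st => ->.
  by right; exists a, w, z, (\sum_j0 f' j0), m', t, X', l', f'; split.
have [[k [kb knb]]|allb] : (exists k : 'I_n, (forall i : 'I_n, i < k -> isbase i)
     /\ nonbase k) \/ (forall i, isbase i).
  have : forall k, k <= n -> (exists k' : 'I_n, (forall i : 'I_n, i < k' -> isbase i)
     /\ nonbase k') \/ (forall i : 'I_n, i < k -> isbase i).
    elim=> [|k IHk] kn; first by right.
    case: IHk => [|?|Hk]; [exact: ltnW | by left |].
    have [b|nb] := dich (Ordinal kn); last by left; exists (Ordinal kn).
    right=> i; rewrite ltnS leq_eqVlt => /orP[/eqP E|]; last exact: Hk.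
    by have -> : i = Ordinal kn by apply: val_inj.
  by case/(_ n (leqnn n)) => [|Hn]; [left | right=> i; apply: Hn].
- have spine : nth Leaf (preds X) k = mk p (drop k l).
    apply: (preds_spine EXl sl) => // i ik.
    by have /= [|_ ?] := kb (Ordinal (ltn_trans ik (ltn_ord k))).
  have [a [w [y [m [m' [t [X' [l' [f' [Wk yw fk Ek [td X'l X't Em Ht]]]]]]]]]]] := knb.
  move: (Ek); rewrite spine => /mk_inj[Ep El'].
  have sl' : size l' = n.-1 - k by rewrite -El' size_drop sl.
  have kn := ltn_ord k.
  have ke : n.-1 - size l' = k by rewrite sl'; lia.
  pose w' := [tuple (if j < k then [::] else if j == k then w else tnth W j) | j < n].
  have Ew' j : tnth W j = seq_of_opt (pop t j) ++ tnth w' j.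
    have [-> _] := Ht j; rewrite tnth_mktuple; case: (ltngtP j k) => [jk|jk|/val_inj->].
    - by rewrite target_of_lt ?ke //=; have [-> _] := kb j jk.
    - by rewrite target_of_gt ?ke //= ?(gtn_eqF jk) //; [case: eqP jk => // ->; rewrite ltnn | lia].
    - by rewrite eqxx -{1}ke target_of_eq.
  have st : step M (p, W) (label t) (target t, [tuple push t j ++ tnth w' j | j < n]).
    exists t, w'; split => //.
    - by move=> j; rewrite -Ew'; apply: cW.
    - by rewrite Ep; congr pair; apply: eq_from_tnth => j; rewrite tnth_mktuple Ew'.
  apply: (@rt_trans _ _ _ (target t, [tuple push t j ++ tnth w' j | j < n])).
    by apply: rt_step; exists (label t).
  (* The new stack j is read in two pieces: the pushed word, by the premises of the consumed edge,
     and what lies below it, by the old edges. Before stack k nothing lies below. *)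
  pose f'' j := f' j + (if j < k then 0 else if j == k then m' else f j).
  apply: (IH X' _ f'') => //; last 2 first.
  - exact: step_is_config st.
  - move=> j; rewrite tnth_mktuple tnth_mktuple; have [_] := Ht j => /pathd_cat; apply.
    case: (ltngtP j k) => [jk|jk|/val_inj->].
    - by rewrite target_of_lt ?ke //=; constructor.
    - rewrite target_of_gt ?ke //=; last lia.
      case: eqP jk => [->|_] jk; first by rewrite ltnn in jk.
      (* The predictions [l'] of the consumed edge are those of [X] for the stacks after k, hence
         the pushed word ends where the old content starts. *)
      suff -> : nth Leaf l' (j - (n - size l')) = nth Leaf (preds X) j by apply: H.
      rewrite EXl -El' nth_drop size_drop sl.
      rewrite (_ : k + _ = j.-1); last by have := ltn_ord j; lia.
      have /prednK <- : 0 < j by lia.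
      by rewrite /= dlistK.
    - by rewrite eqxx -[X in target_of _ _ _ X]ke target_of_eq.
  - rewrite big_split /= -Em -ltnS; apply: leq_trans _ fN.
    rewrite (bigD1 k) //= ltnn eqxx [X in _ < X](bigD1 k) //= fk.
    have : \sum_(i < n | i != k) (if i < k then 0 else if i == k then m' else f i)
       <= \sum_(i < n | i != k) f i.
      by apply: leq_sum => i /negPf ->; case: ifP.
    by rewrite addnA !addSn ltnS leq_add2l.
(* Every stack is down to [bot]. The last one is read from a state without predictions, which cannot
   be a duplicate; so it is [mk q [::]], and the control state is [q]. *)
- have spine : nth Leaf (preds X) n.-1 = mk p (drop n.-1 l).
    apply: (preds_spine EXl sl) => //; last lia.
    move=> i ik; have ilt : i < n by lia.
    by have [] := allb (Ordinal ilt).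
  have lt : n.-1 < n by lia.
  have [_] := allb (Ordinal lt); rewrite /= spine drop_oversize ?sl //.
  case=> [[p' [l' ]]|/mk_inj[-> _]]; first by rewrite preds_cons_dup => /mk_inj[].
  rewrite (_ : W = [tuple [:: bot] | _ < n]); first exact: rt_refl.
  by apply: eq_from_tnth => j; rewrite tnth_mktuple; have [] := allb j.
Qed.

(** * Completeness, for any relation closed under the rules *)

Section Saturated.
Variable R : data -> G -> data -> Prop.
Hypotheses
  (R_sound : forall x g y, R x g y -> exists m, der m x g y)
  (R_typed : forall x g y, R x g y -> exists i,
      [/\ i < n, x \in level i, y = Leaf \/ y \in level i & g = bot <-> y = Leaf])
  (R_closed : forall i x g y, i < n -> x \in level i ->
      y = Leaf \/ y \in level i -> (g = bot <-> y = Leaf) ->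
      base x g y \/ rule R x g y -> R x g y).

Lemma level_size i j x : x \in level i -> x \in level j -> i = j.
Proof. by move=> /level_inv[p [l [-> <- _]]] /level_inv[p' [l' [/mk_inj[_ <-]]]]. Qed.

Lemma path_on_level s w z i : path_on R s w z -> s \in level i ->
  z = Leaf \/ z \in level i.
Proof.
elim: w s => [|a w IH] s /=; first by move->; right.
case=> m /R_typed[i' [_ si' mi' _]] mz si.
have E := level_size si si'; subst i'; case: mi' => [m0|mi]; last exact: IH mz mi.
move: mz; rewrite m0; case: w {IH} => [|b w] /=; first by move<-; left.
by case=> z' /R_typed[i' [_ /level_inv[? [? []]]]].
Qed.

(** Edges start in a level, and the elements of levels are nodes. *)
Lemma path_on_Leaf w z : path_on R Leaf w z -> w = [::].
Proof. by case: w => //= b w [z' /R_typed[i' [_ /level_inv[? [? []]]]]]. Qed.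

Lemma pred_base i x : i.+1 < n -> x \in level i -> R (dup x) bot Leaf.
Proof.
move=> i1n xi; apply: (R_closed i1n) => //.
- by apply: (level_dup 1).
- by left.
- by left; split=> //; left; have [p [l [-> _ _]]] := level_inv xi; exists p, l.
Qed.

Hypothesis M_nf : normal_form M.

(** Both shapes of transitions fit the pattern of [targets]: the first shape with k = 0, the second
    with the stack it pops from. *)
Lemma normal_pop t : t \in delta M -> exists (k : 'I_n) g,
  forall j : 'I_n, pop t j =
    if j < k then Some bot else if j == k then Some g else None.
Proof.
case/M_nf=> [H|[i [g [g' [_ _ _ H]]]]]; last first.
  by exists i, g => j; have [] := H j.
exists (Ordinal n_gt0).
have := H (Ordinal n_gt0) => /=; case E: (pop t _) => [g|//] _.
exists g => j; have := H j; rewrite /= ?ltn0; case: (j =P Ordinal n_gt0) => [->|nj].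
  by rewrite E.
case: eqP => [j0|_ []//]; by case: nj; apply: val_inj.
Qed.

(** Cut the reading of each new stack after the pushed word, at a state [f j]. The states of the
    stacks after k are the predictions of a state x with the source of the transition as control
    state, and closure under [rule] gives the edge from x to [f k]. The stacks before k held only
    [bot], so x is duplicated k times. *)
Lemma complete_step c a c' X' :
  step M c a c' -> X' \in level n.-1 -> dfst X' = code_elt c'.1 ->
  accepts_preds R X' c' ->
  exists X, [/\ X \in level n.-1, dfst X = code_elt c.1 & accepts_preds R X c].
Proof.
case=> t [w [td _ Hw -> ->]] X'l /= X't H.
have [k [g Hp]] := normal_pop td.
have /fin_all_exists[f Hf] : forall j : 'I_n, exists y,
    path_on R (nth Leaf (preds X') j) (push t j) y /\ path_on R y (tnth w j) Leaf.
  by move=> j; have := H j; rewrite tnth_mktuple => /path_on_cat[y]; exists y.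
have kn := ltn_ord k.
(* [s] extends [f] to all numbers, so that the predictions can be listed; entry i of [l] concerns
   stack [k + i.+1]. *)
pose s i : data := if insub i is Some j then f j else Leaf.
have sf (j : 'I_n) : s j = f j by rewrite /s valK.
pose l := mkseq (fun i => s (k + i.+1)) (n.-1 - k).
have sl : size l = n.-1 - k by rewrite size_mkseq.
have ke : n.-1 - size l = k by rewrite sl; lia.
have X'j (j : 'I_n) : nth Leaf (preds X') j \in level (n.-1 - j).
  by apply: nth_preds => //; have := ltn_ord j; lia.
(* If [f j] were [Leaf], nothing would lie below the pushed word; but nothing is popped from stack
   j, which contains at least [bot]. *)
have flev (j : 'I_n) : k < j -> f j \in level (n.-1 - j).
  move=> kj; have [h1 h2] := Hf j.
  case: (path_on_level h1 (X'j j)) => // f0.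
  move: h2; rewrite f0 => /path_on_Leaf wj; have := Hw j.
  by rewrite Hp wj ltnNge (ltnW kj) /=; case: eqP kj => [->|_ _ [[]]//]; rewrite ltnn.
have wlt (j : 'I_n) : j < k -> tnth w j = [::].
  by move=> jk; have := Hw j; rewrite Hp jk => /stack_bot.
have xl : mk (source t) l \in level (n.-1 - k).
  apply: level_intro => // i ik; rewrite nth_mkseq //.
  have i1 : k + i.+1 < n by lia.
  have := flev (Ordinal i1); rewrite -sf /= => h.
  by rewrite (_ : _.-1 = n.-1 - (k + i.+1)); [apply: h; lia | lia].
have xr : R (mk (source t) l) g (f k).
  have [h1 h2] := Hf k; have := Hw k; rewrite Hp ltnn eqxx => stk.
  apply: (R_closed _ xl); [lia | exact: path_on_level h1 (X'j k) | |].
    split=> [gb|f0]; first by move: stk h2; rewrite gb => /stack_bot ->.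
    move: h2 stk; rewrite f0 => /path_on_Leaf -> [[|? [|? ?]] _ [] //].
  right; exists t, X', l; split=> // j; rewrite Hp.
  have [h3 h4] := Hf j.
  case: (ltngtP j k) => [jk|jk|/val_inj E].
  - rewrite target_of_lt ?ke //=; split=> //.
    by move: h4 h3; rewrite wlt //= => ->.
  - rewrite target_of_gt ?ke //= ?sl; [|lia].
    case: eqP jk => [->|_ jk]; first by rewrite ltnn.
    split=> //; rewrite nth_mkseq; last by have := ltn_ord j; lia.
    rewrite (_ : k + _ = j); last by have := ltn_ord j; lia.
    by rewrite sf.
  - by subst j; rewrite eqxx -[X in target_of _ _ _ X]ke target_of_eq.
exists (iter k dup (mk (source t) l)); split.
- by have := level_dup k xl; rewrite subnKC //; lia.
- by rewrite dfst_iter_dup.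
move=> j; rewrite tnth_mktuple nth_preds_dup Hp.
have [h3 h4] := Hf j.
case: (ltngtP j k) => [jk|jk|/val_inj E].
- rewrite wlt //=; exists Leaf => //.
  have -> : k - j = (k - j).-1.+1 by lia.
  apply: (pred_base (i := (k - j).-1 + (n.-1 - k))); first lia.
  exact: level_dup.
- case: eqP jk => [->|_ jk]; first by rewrite ltnn.
  suff -> : nth Leaf (preds (mk (source t) l)) (j - k) = s j.
    by rewrite sf.
  have -> : j - k = (j - k).-1.+1 by lia.
  rewrite /= dlistK nth_mkseq; last by have := ltn_ord j; lia.
  by congr s; lia.
- subst j; rewrite eqxx subnn /=; by exists (f k).
Qed.

Lemma accepts_predsP c :
  (is_config M c /\
   exists X, [/\ X \in level n.-1, dfst X = code_elt c.1 & accepts_preds R X c])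
  <-> pre_star M (fun c' => c' = empty_config M q) c.
Proof.
split=> [[cc [X [Xl Xc H]]]|[cc [_ -> r]]]; split=> //.
  exists (empty_config M q) => //.
  have /fin_all_exists[f Hf] (j : 'I_n) : exists m,
      pathd m (nth Leaf (preds X) j) (tnth c.2 j) Leaf.
    exact: pathd_path_on (H j).
  exact: sound_sized (leqnn _) Xl Xc cc Hf.
have {cc}r1 := clos_rt_rt1n _ _ _ _ r; move Ec: (empty_config M q) r1 => c' {r} r.
elim: r Ec => [c0|c0 c1 c2 [a st] _ IH] E.
  (* In the target all stacks are down to [bot], so every state is obtained by duplication from that
     of the last stack. *)
  subst c0; exists (iter n.-1 dup (mk q [::])).
  have q0 : mk q [::] \in level 0 by apply: map_f; rewrite mem_enum.
  split; [by have := level_dup n.-1 q0; rewrite addn0 | by rewrite dfst_iter_dup |].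
  move=> j; rewrite tnth_mktuple nth_preds_dup /=; exists Leaf => //.
  case: ltnP => jn; last first.
    have -> : j - n.-1 = 0 by have := ltn_ord j; lia.
    apply: (R_closed n_gt0 q0) => //; first by left.
    by left; split=> //; right.
  have -> : n.-1 - j = (n.-1 - j).-1.+1 by lia.
  apply: (pred_base (i := (n.-1 - j).-1 + 0)); first lia.
  exact: level_dup.
have [X [Xl Xc H]] := IH E.
exact: complete_step st Xl Xc H.
Qed.

End Saturated.
End Predictions.

(** * The saturation procedure as a program *)

Arguments den : simpl never.

Definition Fst e := Cs e N0 (V 0).
Definition Snd e := Cs e N0 (V 1).
Notation Eq := (Op OpEq).
Notation And := (Op OpAnd).
Notation Or := (Op OpOr).
Notation Zip := (Op OpZip).
Definition Ex l e := Fold l N0 (Or e (V 0)).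
Definition All l e := Fold l (C N0 N0) (And e (V 0)).

Lemma den_V env k : den env (V k) = nth Leaf env k. Proof. by []. Qed.
Lemma den_N0 env : den env N0 = Leaf. Proof. by []. Qed.
Lemma den_C env a b : den env (C a b) = Node (den env a) (den env b).
Proof. by []. Qed.
Lemma den_Lt env a b : den env (Lt a b) = den (den env a :: env) b.
Proof. by []. Qed.
Lemma den_Op env o a b : den env (Op o a b) = den_op o (den env a) (den env b).
Proof. by []. Qed.
Lemma den_Cs env a b c : den env (Cs a b c) =
  if den env a is Node x y then den (x :: y :: env) c else den env b.
Proof. by []. Qed.
Lemma den_Fold env l i b : den env (Fold l i b) =
  para (fun acc x tl => den (acc :: x :: tl :: env) b) (den env i) (den env l).
Proof. by []. Qed.
Lemma den_Fst env e : den env (Fst e) = dfst (den env e).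
Proof. by rewrite /Fst den_Cs; case: (den env e). Qed.
Lemma den_Snd env e : den env (Snd e) = dsnd (den env e).
Proof. by rewrite /Snd den_Cs; case: (den env e). Qed.
Definition denE := (den_V, den_N0, den_C, den_Lt, den_Fst, den_Snd, den_Op).

Lemma den_eq env a b x y : den env a = x -> den env b = y ->
  den env (Eq a b) = dbool (x == y).
Proof. by move=> <- <-. Qed.

Lemma den_and env a b p r : den env a = dbool p -> den env b = dbool r ->
  den env (And a b) = dbool (p && r).
Proof. by rewrite den_Op => -> ->; case: p. Qed.

Lemma den_or env a b p r : den env a = dbool p -> den env b = dbool r ->
  den env (Or a b) = dbool (p || r).
Proof. by rewrite den_Op => -> ->; case: p. Qed.

Lemma den_Ex env l e p :
  (forall acc x tl, den (acc :: x :: tl :: env) e = dbool (p x)) ->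
  den env (Ex l e) = dbool (has p (unlist (den env l))).
Proof.
move=> H; rewrite /Ex den_Fold; elim: (den env l) => [|x _ tl IH] //=.
by rewrite IH; apply: den_or; rewrite ?H.
Qed.

Lemma den_All env l e p :
  (forall acc x tl, den (acc :: x :: tl :: env) e = dbool (p x)) ->
  den env (All l e) = dbool (all p (unlist (den env l))).
Proof.
move=> H; rewrite /All den_Fold; elim: (den env l) => [|x _ tl IH] //=.
by rewrite IH; apply: den_and; rewrite ?H.
Qed.

Lemma den_collect env l i b (f : data -> seq data) :
  (forall acc x tl, den (acc :: x :: tl :: env) b = dlist (f x ++ unlist acc)) ->
  den env (Fold l i b) =
    dlist (flatten [seq f x | x <- unlist (den env l)] ++ unlist (den env i)).
Proof.
move=> H; rewrite den_Fold.
elim: (den env l) => [|x _ tl IH] /=; first by rewrite unlistK.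
by rewrite IH H dlistK catA.
Qed.

Lemma flatten_seq1 (T : Type) (f : data -> T) s :
  flatten [seq [:: f x] | x <- s] = [seq f x | x <- s].
Proof. by elim: s => //= x s ->. Qed.

Lemma den_map env l i b (f : data -> data) :
  (forall acc x tl, den (acc :: x :: tl :: env) b = Node (f x) acc) ->
  den env (Fold l i b) =
    dlist ([seq f x | x <- unlist (den env l)] ++ unlist (den env i)).
Proof.
move=> H; rewrite (@den_collect _ _ _ _ (fun x => [:: f x])).
  by rewrite flatten_seq1.
by move=> acc x tl; rewrite H /= unlistK.
Qed.

(* An entry pairs a candidate edge (x, g, y) of the saturated automaton with
   the list [targets], which a transition giving rise to it has to match. *)
Definition edge_of (e : data) : data := dfst e.
Definition edge_src (e : data) : data := dfst (dfst e).
Definition edge_sym (e : data) : data := dfst (dsnd (dfst e)).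
Definition edge_tgt (e : data) : data := dsnd (dsnd (dfst e)).
Definition edge (x g y : data) : data := Node x (Node g y).

(** Pushed words have length at most 2, so no recursion along the word is necessary; anything after
    the second letter is ignored. *)
Definition path_via (T : seq data) (s w z : data) : bool :=
  match w with
  | Leaf => s == z
  | Node a Leaf => has (fun e => edge_of e == edge s a z) T
  | Node a (Node b _) =>
      has (fun e => (edge_src e == s) && (edge_sym e == a) &&
             has (fun e' => edge_of e' == edge (edge_tgt e) b z) T) T
  end.

Definition path_prog : lang :=
  Cs (V 1) (Eq (V 0) (V 2))
    (Cs (V 1)
      (Ex (V 5) (Eq (Fst (V 1)) (C (V 5) (C (V 3) (V 7)))))
      (Ex (V 7)
        (And (And (Eq (Fst (Fst (V 1))) (V 7)) (Eq (Fst (Snd (Fst (V 1)))) (V 5)))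
          (Ex (V 10)
            (Eq (Fst (V 1)) (C (Snd (Snd (Fst (V 4)))) (C (V 6) (V 12)))))))).

Lemma den_path env s w z T : den [:: s, w, z, T & env] path_prog =
  dbool (path_via (unlist T) s w z).
Proof.
rewrite /path_prog den_Cs denE /=; case: w => [|a [|b w]] /=; first by [].
  by rewrite den_Cs denE /= (@den_Ex _ _ _ (fun e => edge_of e == edge s a z)).
rewrite den_Cs denE /=; apply: den_Ex => acc e tl.
apply: den_and; first by apply: den_and; apply: den_eq; rewrite !denE.
by rewrite (@den_Ex _ _ _ (fun e' => edge_of e' == edge (edge_tgt e) b z)).
Qed.

(** If there are predictions, the first one must be the state without it, that is, [x] is a [dup];
    if there are none, [x] belongs to the last stack. *)
Definition base_via (q x y : data) : bool :=
  (y == Leaf) && (if dsnd x is Node z l then z == Node (dfst x) l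
                  else dfst x == q).

Definition tr_src (t : data) : data := dfst t.
Definition tr_pops (t : data) : data := dfst (dsnd t).
Definition tr_tgt (t : data) : data := dfst (dsnd (dsnd (dsnd t))).
Definition tr_pushes (t : data) : data := dfst (dsnd (dsnd (dsnd (dsnd t)))).

Definition match_via (T : seq data) (e : data) : bool :=
  (dfst (dfst e) == dfst (dfst (dsnd e))) &&
  path_via T (dsnd (dsnd e)) (dsnd (dfst e)) (dsnd (dfst (dsnd e))).

(** Four lists indexed by the stacks are zipped: pops, pushes, [targets], and [preds X], whose code
    is [Node X (dsnd X)]. *)
Definition rule_via (T D L : seq data) (x tau : data) : bool :=
  has (fun t => has (fun X =>
    (tr_src t == dfst x) && (tr_tgt t == dfst X) &&
    all (match_via T) (unlist (zipd (zipd (tr_pops t) (tr_pushes t))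
                                    (zipd tau (Node X (dsnd X)))))) L) D.

Definition check (D L : seq data) (bot q : data) (T : seq data) (e : data) :
    bool :=
  ((edge_sym e == bot) == (edge_tgt e == Leaf)) &&
  (base_via q (edge_src e) (edge_tgt e)
   || rule_via T D L (edge_src e) (dsnd e)).

(** After the four bindings, variables 0 to 4 are x, g, y, the list of targets and the entry itself;
    5 to 9 are T, D, L, bot and q. *)
Definition check_prog : lang :=
  Lt (Snd (V 0)) (Lt (Snd (Snd (Fst (V 1))))
    (Lt (Fst (Snd (Fst (V 2)))) (Lt (Fst (Fst (V 3)))
  (And (Eq (Eq (V 1) (V 8)) (Eq (V 2) N0))
    (Or
      (And (Eq (V 2) N0)
        (Cs (Snd (V 0)) (Eq (Fst (V 0)) (V 9))
          (Eq (V 0) (C (Fst (V 2)) (V 1)))))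
      (Ex (V 6) (Ex (V 10)
        (And (And (Eq (Fst (V 4)) (Fst (V 6)))
                  (Eq (Fst (Snd (Snd (Snd (V 4))))) (Fst (V 1))))
          (All (Zip (Zip (Fst (Snd (V 4))) (Fst (Snd (Snd (Snd (Snd (V 4)))))))
                    (Zip (V 9) (C (V 1) (Snd (V 1)))))
            (And (Eq (Fst (Fst (V 1))) (Fst (Fst (Snd (V 1)))))
              (Lt (V 14) (Lt (Snd (Fst (Snd (V 2)))) (Lt (Snd (Fst (V 3)))
                 (Lt (Snd (Snd (V 4))) path_prog)))))))))))))).

Lemma dbool_inj : injective dbool. Proof. by case=> -[]. Qed.

Lemma den_check env e T D L bot q :
  den [:: e, T, D, L, bot, q & env] check_prog =
  dbool (check (unlist D) (unlist L) bot q (unlist T) e).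
Proof.
rewrite /check_prog; do 4 rewrite den_Lt; rewrite !(den_Fst, den_Snd, den_V) /=.
apply: den_and.
  by rewrite (@den_eq _ _ _ (dbool (edge_sym e == bot)) (dbool (edge_tgt e == Leaf)))
    // ?(inj_eq dbool_inj).
apply: den_or.
  apply: den_and; first exact: den_eq.
  rewrite den_Cs den_Snd denE /= -/(edge_src e).
  by case: (dsnd (edge_src e)) => [|z l] //; apply: den_eq; rewrite !denE.
apply: den_Ex => acc t tl; rewrite (@den_Ex _ _ _ (fun X =>
    (tr_src t == dfst (edge_src e)) && (tr_tgt t == dfst X) &&
    all (match_via (unlist T)) (unlist (zipd (zipd (tr_pops t) (tr_pushes t))
                                    (zipd (dsnd e) (Node X (dsnd X))))))) //.
move=> acc1 X tl1; apply: den_and.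
  by apply: den_and; apply: den_eq; rewrite !denE.
rewrite (@den_All _ _ _ (match_via (unlist T))).
  by rewrite !denE.
move=> acc' z tl'; apply: den_and; first by apply: den_eq; rewrite !denE.
by rewrite !denE /= den_path.
Qed.

(** * Programs for the levels and the candidate edges *)

Definition range_prog : lang :=
  Fold (V 0) N0 (C N0 (Fold (V 0) N0 (C (C N0 (V 1)) (V 0)))).

(** A unary number is a list of leaves, so a fold can count with it; passing from k to k + 1
    prepends 0 and increments all other entries. *)
Lemma den_range env k : den (code_nat k :: env) range_prog =
  dlist [seq code_nat i | i <- iota 0 k].
Proof.
have H env' j : para (fun acc x tl => den (acc :: x :: tl :: env')
    (C N0 (Fold (V 0) N0 (C (C N0 (V 1)) (V 0))))) Leaf (code_nat j) =
    dlist [seq code_nat i | i <- iota 0 j]; last exact: H.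
elim: j => [|j IH] //.
rewrite [LHS]/= -/(code_nat j) IH den_C (@den_map _ _ _ _ (Node Leaf)) //.
rewrite !denE /= dlistK cats0 -(addn0 1) iotaDl -!map_comp.
by congr (Node _ (dlist _)); apply: eq_map.
Qed.

Definition extend_prog : lang :=
  Fold (V 0) N0 (Fold (V 3) (V 0)
    (C (C (Fst (V 1)) (C (V 4) (Snd (V 1)))) (V 0))).

Lemma den_extend env L : den (dlist L :: env) extend_prog = dlist (extend L).
Proof.
rewrite (@den_collect _ _ _ _
  (fun x => [seq Node (dfst v) (Node x (dsnd v)) | v <- L])).
  by rewrite !denE /= dlistK cats0.
move=> acc x tl.
rewrite (@den_map _ _ _ _ (fun v => Node (dfst v) (Node x (dsnd v)))).
  by rewrite !denE /= dlistK.
by move=> acc' v tl'; rewrite !denE.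
Qed.

(** Level i belongs to stack [n.-1 - i]; one level up there is one stack fewer before it, so an
    entry of the padding is dropped. *)
Definition level_body : lang :=
  C (C (Snd (Fst (Fst (V 0)))) (Lt (Snd (Fst (V 0))) extend_prog)) (V 0).

Definition levels_prog : lang :=
  Fold (Snd (V 0))
    (C (C (Fold (Snd (V 0)) N0 (C (C (C (V 5) N0) N0) (V 0))) (V 1)) N0)
    level_body.

(** Code of the entries [(Some bot, Leaf)] at the beginning of [targets]. *)
Definition padding (bot : data) (k : nat) : data :=
  dlist (nseq k (Node (Node bot Leaf) Leaf)).

Fixpoint level_list (bot : data) (L : seq data) (k i : nat) : seq data :=
  Node (padding bot (k - i)) (dlist (iter i extend L)) ::
  (if i is j.+1 then level_list bot L k j else [::]).

Lemma level_list_head bot L k i : exists s, level_list bot L k i =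
  Node (padding bot (k - i)) (dlist (iter i extend L)) :: s.
Proof. by case: i => [|i]; eexists. Qed.

Lemma den_level_body env bot L n i : i < n ->
  den (dlist (level_list bot L n i) :: env) level_body =
  dlist (level_list bot L n i.+1).
Proof.
move=> ni /=; have [s E] := level_list_head bot L n i.
rewrite !denE E /= den_extend /padding -(subnSK ni); congr (Node (Node _ _) _).
Qed.

Lemma den_levels_init env n bot L :
  den [:: Node Leaf (code_nat n), dlist L, bot & env]
    (C (C (Fold (Snd (V 0)) N0 (C (C (C (V 5) N0) N0) (V 0))) (V 1)) N0) =
  dlist (level_list bot L n 0).
Proof.
rewrite !denE (@den_map _ _ _ _ (fun => Node (Node bot Leaf) Leaf)) //.
rewrite !denE /= cats0 subn0 /padding; congr (Node (Node (dlist _) _) _).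
by elim: (n) => //= k ->.
Qed.

Lemma den_levels env n L bot : den [:: code_nat n.+1, dlist L, bot & env] levels_prog =
  dlist (level_list bot L n n).
Proof.
rewrite /levels_prog den_Fold den_Snd den_V /= -/(code_nat n) den_levels_init.
suff H i : i <= n -> para (fun acc x tl => den [:: acc, x, tl, Node Leaf (code_nat n),
    dlist L, bot & env] level_body) (dlist (level_list bot L n 0)) (code_nat i) =
  dlist (level_list bot L n i) by apply: H.
by elim: i => [|i IH] ni //=; rewrite IH ?(ltnW ni) // den_level_body.
Qed.

Definition entry (pad x g y : data) : data :=
  Node (edge x g y) (dlist (unlist pad ++ Node (Node g Leaf) y ::
                            [seq Node Leaf s | s <- unlist (dsnd x)])).

Definition universe (Ls gs : seq data) : seq data :=
  flatten [seq flatten [seq flatten [seq [seq entry (dfst lv) x g y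
    | y <- Leaf :: unlist (dsnd lv)] | g <- gs] | x <- unlist (dsnd lv)] | lv <- Ls].

Definition universe_prog : lang :=
  Fold (V 0) N0 (Fold (Snd (V 1)) (V 0) (Fold (V 7) (V 0)
    (Fold (C N0 (Snd (V 7))) (V 0)
      (C (C (C (V 7) (C (V 4) (V 1)))
            (Fold (Fst (V 10))
               (C (C (C (V 4) N0) (V 1)) (Fold (Snd (V 7)) N0 (C (C N0 (V 1)) (V 0))))
               (C (V 1) (V 0))))
         (V 0))))).

Lemma den_universe env Ls gs : den [:: dlist Ls, dlist gs & env] universe_prog =
  dlist (universe Ls gs).
Proof.
rewrite (@den_collect _ _ _ _ (fun lv => flatten [seq flatten [seq [seq entry (dfst lv) x g y
    | y <- Leaf :: unlist (dsnd lv)] | g <- gs] | x <- unlist (dsnd lv)])).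
  by rewrite !denE /= dlistK cats0.
move=> acc lv tl; rewrite (@den_collect _ _ _ _ (fun x => flatten [seq [seq entry (dfst lv) x g y
    | y <- Leaf :: unlist (dsnd lv)] | g <- gs])); first by rewrite !denE.
move=> acc1 x tl1; rewrite (@den_collect _ _ _ _ (fun g => [seq entry (dfst lv) x g y
    | y <- Leaf :: unlist (dsnd lv)])); first by rewrite !denE /= dlistK.
move=> acc2 g tl2; rewrite (@den_map _ _ _ _ (entry (dfst lv) x g)); first by rewrite !denE.
move=> acc3 y tl3; rewrite den_C; congr Node.
rewrite !denE /= (@den_map _ _ _ _ id) // !denE map_id /=; congr (Node _ (dlist (_ ++ _))).
rewrite (@den_map _ _ _ _ (Node Leaf)) // !denE /= cats0.
by rewrite dlistK.
Qed.

Definition sat (D L : seq data) (bot q : data) (U : seq data) : seq data :=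
  iter (size U) (fun T => filter (check D L bot q T) U) [::].

(** The outer fold uses the universe only to count the rounds. *)
Definition sat_prog : lang :=
  Fold (V 0) N0 (Fold (V 3) N0
    (Cs (Lt (V 10) (Lt (V 10) (Lt (V 10) (Lt (V 10) (Lt (V 7)
          (Lt (V 6) check_prog))))))
       (V 0) (C (V 3) (V 2)))).

Lemma flatten_filter (p : pred data) s :
  flatten [seq if p x then [:: x] else [::] | x <- s] = filter p s.
Proof. by elim: s => //= x s ->; case: (p x). Qed.

Lemma den_sat_round env T x tl U D L bot q :
  den [:: T, x, tl, U, D, L, bot, q & env]
    (Fold (V 3) N0
    (Cs (Lt (V 10) (Lt (V 10) (Lt (V 10) (Lt (V 10) (Lt (V 7)
          (Lt (V 6) check_prog))))))
       (V 0) (C (V 3) (V 2)))) =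
  dlist (filter (check (unlist D) (unlist L) bot q (unlist T)) (unlist U)).
Proof.
rewrite (@den_collect _ _ _ _ (fun e =>
   if check (unlist D) (unlist L) bot q (unlist T) e then [:: e] else [::])).
  by rewrite flatten_filter !denE cats0.
move=> acc e tl'; rewrite den_Cs; do 6 rewrite den_Lt; rewrite !den_V /= den_check.
by case: check => /=; rewrite ?denE ?unlistK.
Qed.

Lemma den_sat env U D L bot q :
  den [:: U, D, L, bot, q & env] sat_prog =
  dlist (sat (unlist D) (unlist L) bot q (unlist U)).
Proof.
rewrite /sat_prog den_Fold den_N0 den_V [nth _ _ _]/= /sat.
elim: {2 3}U => [|x _ d IH] //=.
by rewrite IH den_sat_round dlistK.
Qed.

(** An edge into [Leaf] ends a stack: the first prediction in [v] becomes the current state and is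
    removed from [v]. If there is none left, all stacks have been read. *)
Definition next_via (T : seq data) (u v g b : data) : bool :=
  has (fun e => (edge_src e == u) && (edge_sym e == g) &&
    (b == if edge_tgt e is Node _ _ then Node (edge_tgt e) v
          else if dsnd v is Node s l then Node s (Node (dfst v) l) else Leaf)) T.

Definition next_prog : lang :=
  Ex (V 4) (And
    (And (Eq (Fst (Fst (V 1))) (V 3)) (Eq (Fst (Snd (Fst (V 1)))) (V 5)))
    (Cs (Snd (Snd (Fst (V 1))))
      (Eq (V 6) (Cs (Snd (V 4)) N0 (C (V 0) (C (Fst (V 6)) (V 1)))))
      (Eq (V 8) (C (Snd (Snd (Fst (V 3)))) (V 6))))).

Lemma den_next env u v g b T :
  den [:: u, v, g, b, T & env] next_prog = dbool (next_via (unlist T) u v g b).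
Proof.
apply: den_Ex => acc e tl; apply: den_and.
  by apply: den_and; apply: den_eq; rewrite !denE.
rewrite den_Cs !(den_Fst, den_Snd, den_V) /= -/(edge_tgt e); case E: (edge_tgt e) => [|y1 y2].
  by apply: den_eq; rewrite // den_Cs !denE /=; case: (dsnd v) => [|s l]; rewrite ?denE.
by apply: den_eq; rewrite !denE //= -/(edge_tgt e) E.
Qed.

(** The shapes of data distinguish the states: [Leaf] is accepting, [Node Leaf p] is the control
    state p, which guesses [X] while reading its first letter, and a pair has a node on the left. *)
Definition edge_via (T L : seq data) (a g b : data) : bool :=
  match a with
  | Leaf => false
  | Node Leaf p => has (fun X => (dfst X == p) && next_via T X X g b) L
  | Node (Node _ _ as u) v => next_via T u v g b
  end.

Definition edge_prog : lang :=
  Cs (V 0) N0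
    (Cs (V 0)
      (Ex (V 6) (And (Eq (Fst (V 1)) (V 4))
         (Lt (V 8) (Lt (V 8) (Lt (V 8) (Lt (V 4) (Lt (V 5) next_prog)))))))
      (Lt (V 7) (Lt (V 7) (Lt (V 7) (Lt (V 6) (Lt (V 6) next_prog)))))).

Lemma den_edge env a g b T L : den [:: a, g, b, T, L & env] edge_prog =
  dbool (edge_via (unlist T) (unlist L) a g b).
Proof.
rewrite /edge_prog den_Cs den_V /=; case: a => [|u v] //.
rewrite den_Cs den_V /=; case: u => [|u1 u2].
  apply: den_Ex => acc X tl; apply: den_and; first by apply: den_eq; rewrite !denE.
  by do 5 rewrite den_Lt; rewrite !den_V /= den_next.
by do 5 rewrite den_Lt; rewrite !den_V /= den_next.
Qed.

Definition pairs (Ls : seq data) : seq data :=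
  flatten [seq [seq Node u v | u <- unlist (dsnd lv), v <- unlist (dsnd lv)] | lv <- Ls].

Definition aut_states (Ls qs : seq data) : seq data :=
  [seq Node Leaf p | p <- qs] ++ Leaf :: pairs Ls.

Definition states_prog : lang :=
  Fold (V 1)
    (C N0 (Fold (V 0) N0 (Fold (Snd (V 1)) (V 0) (Fold (Snd (V 4)) (V 0)
       (C (C (V 4) (V 1)) (V 0))))))
    (C (C N0 (V 1)) (V 0)).

Lemma den_states env Ls qs : den [:: dlist Ls, dlist qs & env] states_prog =
  dlist (aut_states Ls qs).
Proof.
rewrite (@den_map _ _ _ _ (Node Leaf)) // !denE /= dlistK; congr (dlist (_ ++ _ :: _)).
rewrite (@den_collect _ _ _ _
  (fun lv => [seq Node u v | u <- unlist (dsnd lv), v <- unlist (dsnd lv)])).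
  by rewrite !denE /= !dlistK cats0.
move=> acc lv tl.
rewrite (@den_collect _ _ _ _ (fun u => [seq Node u v | v <- unlist (dsnd lv)])).
  by rewrite !denE.
move=> acc1 u tl1; rewrite (@den_map _ _ _ _ (Node u)) // !denE.
Qed.

Definition index_prog : lang :=
  Fold (V 0) N0 (C (C N0 (V 1))
    (Fold (V 0) N0 (C (C (C N0 (Fst (V 1))) (Snd (V 1))) (V 0)))).

Definition indexed (L : seq data) : seq data :=
  [seq Node (code_nat i) (nth Leaf L i) | i <- iota 0 (size L)].

Lemma den_index env L : den (dlist L :: env) index_prog = dlist (indexed L).
Proof.
have H env' L' : para (fun acc x tl => den (acc :: x :: tl :: env')
    (C (C N0 (V 1)) (Fold (V 0) N0 (C (C (C N0 (Fst (V 1))) (Snd (V 1))) (V 0)))))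
    Leaf (dlist L') = dlist (indexed L'); last exact: H.
elim: L' => [|x L' IH] //.
rewrite [LHS]/= IH den_C (@den_map _ _ _ _ (fun p => Node (Node Leaf (dfst p)) (dsnd p))) //.
rewrite !denE /= dlistK cats0 /indexed /= -(addn0 1) iotaDl -!map_comp.
by congr (Node _ (dlist _)); apply: eq_map.
Qed.

Definition delta_list (T L A gs : seq data) : seq data :=
  flatten [seq flatten [seq flatten [seq
    if edge_via T L (dsnd a) g (dsnd b)
    then [:: dlist [:: dfst a; g; dfst b]] else [::]
    | b <- indexed A] | g <- gs] | a <- indexed A].

Definition delta_prog : lang :=
  Fold (V 0) N0 (Fold (V 4) (V 0) (Fold (V 6) (V 0)
    (Cs (Lt (V 12) (Lt (V 12) (Lt (Snd (V 3)) (Lt (V 7) (Lt (Snd (V 11)) edge_prog)))))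
      (V 0)
      (C (C (Fst (V 9)) (C (V 6) (C (Fst (V 3)) N0))) (V 2))))).

Lemma den_delta env A gs T L :
  den [:: dlist (indexed A), dlist gs, dlist T, dlist L & env] delta_prog =
  dlist (delta_list T L A gs).
Proof.
rewrite (@den_collect _ _ _ _ (fun a => flatten [seq flatten [seq
    if edge_via T L (dsnd a) g (dsnd b)
    then [:: dlist [:: dfst a; g; dfst b]] else [::]
    | b <- indexed A] | g <- gs])); first by rewrite !denE /= dlistK cats0.
move=> acc a tl; rewrite (@den_collect _ _ _ _ (fun g => flatten [seq
    if edge_via T L (dsnd a) g (dsnd b)
    then [:: dlist [:: dfst a; g; dfst b]] else [::]
    | b <- indexed A])); first by rewrite !denE /= dlistK.
move=> acc1 g tl1; rewrite (@den_collect _ _ _ _ (fun b =>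
    if edge_via T L (dsnd a) g (dsnd b)
    then [:: dlist [:: dfst a; g; dfst b]] else [::])); first by rewrite !denE /= dlistK.
move=> acc2 b tl2; rewrite den_Cs; do 5 rewrite den_Lt.
rewrite !(den_Fst, den_Snd, den_V) /= den_edge !dlistK.
by case: edge_via => /=; rewrite ?denE ?unlistK.
Qed.

Definition main_prog : lang :=
  Lt (Lt (Fst (Snd (Snd (Snd (Fst (V 0)))))) range_prog)
  (Lt (Lt (Fst (Snd (Fst (V 1)))) range_prog)
  (Lt (Lt (Fst (Snd (Snd (Snd (Snd (Fst (V 2)))))))
        (Lt (Fold (V 1) N0 (C (C (V 1) N0) (V 0)))
          (Lt (Fst (Fst (V 4))) levels_prog)))
  (Lt (Lt (Fst (Snd (V 3)))
        (Lt (Fst (Snd (Snd (Snd (Snd (Fst (V 4)))))))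
          (Lt (Snd (Fst (V 2)))
            (Lt (Fst (Snd (Snd (Snd (Snd (Snd (Fst (V 6))))))))
              (Lt (Lt (V 6) (Lt (V 5) universe_prog)) sat_prog)))))
  (Lt (Lt (V 2) (Lt (V 2) states_prog))
  (C (Fold (V 0) N0 (C N0 (V 0)))
  (C (Fst (Snd (Snd (Snd (Fst (V 5))))))
  (C (Lt (Snd (Fst (V 2))) (Lt (V 2) (Lt (V 6) (Lt (Lt (V 3) index_prog) delta_prog))))
  (C (V 3)
  (C (C (Fst (Snd (Fst (V 5)))) N0) N0))))))))).

(** * Correctness of the saturation procedure *)

Section FilterFixpoint.
Variables (T : eqType) (U : seq T) (p : seq T -> pred T).
Hypothesis p_mono : forall s s', {subset s <= s'} -> subpred (p s) (p s').
Let F s := filter (p s) U.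

Lemma filter_stage_sub i : {subset iter i F [::] <= iter i.+1 F [::]}.
Proof.
elim: i => [|i IH] x //=; rewrite !mem_filter => /andP[px ->].
by rewrite andbT; apply: p_mono px.
Qed.

(** The stages form an increasing chain of subsequences of [U]: each one is longer than the previous
    one until the chain becomes constant, which takes at most [size U] rounds. *)
Lemma filter_fixpoint : F (iter (size U) F [::]) = iter (size U) F [::].
Proof.
have H i : iter i.+1 F [::] = iter i F [::] \/ i.+1 <= size (iter i.+1 F [::]).
  elim: i => [|i IH].
    by case E: (iter 1 F [::]) => [|x s]; [left | right].
  case: IH => [E|IH]; first by left; rewrite iterS E.
  have ss : subseq (iter i.+1 F [::]) (iter i.+2 F [::]).
    have sub := p_mono (@filter_stage_sub i).
    suff -> : iter i.+1 F [::] = filter (p (iter i F [::])) (iter i.+2 F [::]).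
      exact: filter_subseq.
    rewrite /= /F -filter_predI; apply: eq_filter => x /=.
    by case E: (p (iter i F [::]) x) => //=; have := sub x E; rewrite /= /F => ->.
  have [le eq] := size_subseq_leqif ss.
  move: le; rewrite leq_eqVlt eq => /orP[/eqP <-|lt]; first by left.
  by right; apply: leq_ltn_trans IH lt.
case: (H (size U)) => // h.
by have := leq_trans h (_ : _ <= size U); rewrite ltnn /= /F size_filter count_size => /(_ isT).
Qed.

End FilterFixpoint.

Lemma code_seqE (T : Type) (code : T -> data) s :
  code_seq code s = dlist [seq code x | x <- s].
Proof. by elim: s => //= x s ->. Qed.

Lemma unlist_code_seq (T : Type) (code : T -> data) s :
  unlist (code_seq code s) = [seq code x | x <- s].
Proof. by rewrite code_seqE dlistK. Qed.

Lemma unlist_zipd a b :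
  unlist (zipd a b) = [seq Node p.1 p.2 | p <- zip (unlist a) (unlist b)].
Proof. by elim: a b => [|x _ a IH] [|y b] //=; rewrite IH. Qed.

Lemma zip_map2 (T A B : Type) (f : T -> A) (g : T -> B) s :
  zip (map f s) (map g s) = [seq (f x, g x) | x <- s].
Proof. by elim: s => //= x s ->. Qed.

Lemma map_nth_ord (T : Type) x0 n (s : seq T) : size s = n ->
  s = [seq nth x0 s (val j) | j <- enum 'I_n].
Proof.
move=> sn; rewrite (map_comp (nth x0 s) val) val_enum_ord -sn.
by rewrite map_nth_iota0 ?take_size.
Qed.

Lemma code_elt_enum (T : finType) :
  [seq code_elt x | x <- enum T] = [seq code_nat i | i <- iota 0 #|T|].
Proof.
apply: (@eq_from_nth _ Leaf).
  by rewrite size_map -cardE size_map size_iota.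
move=> i; rewrite size_map -cardE => iT.
have x0 := enum_val (Ordinal iT).
rewrite (nth_map x0) -?cardE // (nth_map 0) ?size_iota // nth_iota // add0n.
by rewrite -(enum_val_nth x0 (Ordinal iT)) /code_elt enum_valK.
Qed.

Section Check.
Variables (n : nat) (Q S G : finType) (M : mpa n Q S G) (q : Q).
Hypothesis n_gt0 : 0 < n.
Notation bot := (bot M).
Notation cG := (@code_elt G).
Let D := [seq code_transition t | t <- enum (delta M)].
Let gs := [seq cG g | g <- enum G].
Let L0 := [seq mk p [::] | p <- enum Q].
Let Ls := level_list (cG bot) L0 n.-1 n.-1.
Let U := universe Ls gs.

Definition edge_in (T : seq data) (x : data) (g : G) (y : data) : Prop :=
  has (fun e => edge_of e == edge x (cG g) y) T.

Lemma mem_level_list lv : lv \in Ls <->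
  exists2 i, i < n & lv = Node (padding (cG bot) (n.-1 - i)) (dlist (level Q i)).
Proof.
have H k i : lv \in level_list (cG bot) L0 k i <->
  exists2 j, j <= i & lv = Node (padding (cG bot) (k - j)) (dlist (level Q j)).
  elim: i => [|i IH].
    rewrite /= inE; split=> [/eqP ->|[j]]; first by exists 0.
    by rewrite leqn0 => /eqP -> ->.
  rewrite /= inE; split=> [/orP[/eqP ->|/IH[j ji ->]]|[j]]; first by exists i.+1.
    by exists j => //; apply: ltnW.
  rewrite leq_eqVlt => /orP[/eqP -> ->|ji E]; first by rewrite eqxx.
  by apply/orP; right; apply/IH; exists j.
rewrite /Ls H; split=> -[j ji ->]; exists j => //; lia.
Qed.

Lemma mem_universe e : e \in U <-> exists i x g y,
  [/\ i < n, x \in level Q i, y = Leaf \/ y \in level Q i &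
     e = entry (padding (cG bot) (n.-1 - i)) x (cG g) y].
Proof.
split=> [/flatten_mapP[lv /mem_level_list[i ilt ->]]|].
  rewrite [dfst _]/= [dsnd _]/= dlistK => /flatten_mapP[x xi].
  case/flatten_mapP=> c; rewrite {1}/gs => /mapP[g _ ->].
  case/mapP=> y yl ->; exists i, x, g, y; split=> //.
  by move: yl; rewrite inE => /orP[/eqP|]; [left | right].
case=> i [x [g [y [ilt xi yi ->]]]].
apply/flatten_mapP; exists (Node (padding (cG bot) (n.-1 - i)) (dlist (level Q i))).
  by apply/mem_level_list; exists i.
rewrite [dfst _]/= [dsnd _]/= dlistK; apply/flatten_mapP; exists x => //.
apply/flatten_mapP; exists (cG g); first by apply: map_f; rewrite mem_enum.
apply: (map_f (entry (padding (cG bot) (n.-1 - i)) x (cG g))).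
by rewrite inE; case: yi => [->|->]; rewrite ?orbT.
Qed.

Lemma edge_inj x g y x' g' y' : edge x (cG g) y = edge x' (cG g') y' ->
  [/\ x = x', g = g' & y = y'].
Proof. by case=> -> /code_elt_inj -> ->. Qed.

Section Sub.
Variable T : seq data.
Hypothesis T_sub : {subset T <= U}.

Lemma path_viaP s (w : seq G) z : size w <= 2 ->
  path_via T s (code_seq cG w) z <-> path_on (edge_in T) s w z.
Proof.
case: w => [|a [|b [|//]]] _ /=; first by split=> /eqP.
  by split=> [H|[m H <-]] //; exists z.
split=> [/hasP[e eT /andP[/andP[/eqP es /eqP ea]] H]|[m ma [z' H <-]]].
  exists (edge_tgt e); last by exists z.
  apply/hasP; exists e => //; apply/eqP; rewrite -es -ea.
  (* The projections are total, so an edge can be rebuilt from them only because it is known to be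
     an entry of the universe. *)
  by have /mem_universe[i [x [g [y [_ _ _ ->]]]]] := T_sub eT.
case/hasP: ma => e eT /eqP E; apply/hasP; exists e => //.
move: H; rewrite /edge_in /edge_src /edge_sym /edge_tgt; move: E.
by rewrite /edge_of => -> /= ->; rewrite !eqxx.
Qed.

Definition code_target (p : option G * data) : data :=
  Node (code_option cG p.1) p.2.

Lemma code_option_inj : injective (code_option cG).
Proof. by case=> [g|] [h|] //= [/code_elt_inj ->]. Qed.

Lemma entry_targets (p : Q) l g y :
  dsnd (entry (padding (cG bot) (n.-1 - size l)) (mk p l) (cG g) y) =
  dlist [seq code_target z | z <- targets M (n.-1 - size l) g y l].
Proof.
rewrite /entry /= /padding !dlistK map_cat map_nseq /=; congr (dlist (_ ++ _ :: _)).
by rewrite -map_comp.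
Qed.

Lemma match_viaP (t : transition n Q S G) X l g y : size l < n -> X \in level Q n.-1 ->
  all (match_via T) (unlist (zipd
    (zipd (tr_pops (code_transition t)) (tr_pushes (code_transition t)))
    (zipd (dlist [seq code_target z | z <- targets M (n.-1 - size l) g y l])
       (Node X (dsnd X))))) <->
  forall j : 'I_n, pop t j = (target_of M g y l j).1 /\
    path_on (edge_in T) (nth Leaf (preds X) j) (push t j) (target_of M g y l j).2.
Proof.
move=> ln Xl; rewrite !unlist_zipd dlistK.
have -> : targets M (n.-1 - size l) g y l =
    [seq target_of M g y l (val j) | j <- enum 'I_n].
  apply: map_nth_ord; rewrite size_cat /= size_nseq size_map; lia.
have -> : unlist (Node X (dsnd X)) = [seq nth Leaf (preds X) (val j) | j <- enum 'I_n].
  apply: map_nth_ord; have [p [l' [-> sl _]]] := level_inv Xl.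
  by rewrite /= dlistK sl prednK.
rewrite /tr_pops /tr_pushes /= !unlist_code_seq.
have me (j : 'I_n) : j \in enum 'I_n by rewrite mem_enum.
move: (enum 'I_n) me => s me.
rewrite -!map_comp !zip_map2 -!map_comp zip_map2 -!map_comp all_map.
split=> [/allP H j|H].
  have := H j (me j); rewrite /= /match_via /=.
  move=> /andP[/eqP/code_option_inj-> /path_viaP]; rewrite size_bseq => /(_ isT).
  by [].
apply/allP=> j _; have [E P] := H j; rewrite /= /match_via /= E eqxx.
by apply/path_viaP => //; rewrite size_bseq.
Qed.

Lemma base_viaP (p : Q) l y : base_via (code_elt q) (mk p l) y <->
  y = Leaf /\ ((exists (p' : Q) l', mk p l = dup (mk p' l')) \/ mk p l = mk q [::]).
Proof.
rewrite /base_via; split=> [/andP[/eqP -> H]|[-> H]]; last first.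
  rewrite eqxx; case: H => [[p' [l' E]]|/mk_inj[-> ->]] /=; last by rewrite eqxx.
  by move: E; rewrite preds_cons_dup => /mk_inj[-> ->] /=; rewrite eqxx.
split=> //; case: l H => [|z l] /= /eqP H; first by right; rewrite (code_elt_inj H).
by left; exists p, l; rewrite H.
Qed.

Lemma checkP i x g y : i < n -> x \in level Q i ->
  check D (level Q n.-1) (cG bot) (code_elt q) T
    (entry (padding (cG bot) (n.-1 - i)) x (cG g) y) <->
  (g = bot <-> y = Leaf) /\ (base M q x g y \/ rule M (edge_in T) x g y).
Proof.
move=> ilt xi; have [p [l [Ex sl _]]] := level_inv xi; subst x i.
rewrite /check entry_targets.
have Ebot : ((edge_sym (entry (padding (cG bot) (n.-1 - size l)) (mk p l) (cG g) y) == cG bot)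
   == (y == Leaf)) <-> (g = bot <-> y = Leaf).
  rewrite /edge_sym /= (inj_eq (@code_elt_inj G)).
  by case: (g =P bot); case: (y =P Leaf) => ? ?; rewrite /=; split=> //; tauto.
have Erule : rule_via T D (level Q n.-1) (mk p l)
   (dlist [seq code_target z | z <- targets M (n.-1 - size l) g y l]) <->
   rule M (edge_in T) (mk p l) g y.
  split=> [/hasP[_ /mapP[t tD ->] /hasP[X Xl /andP[/andP[/eqP ts /eqP tX]]]]|].
    move=> /(match_viaP _ _ _ ilt Xl) H; exists t, X, l; split=> //.
    - by rewrite mem_enum in tD.
    - by move: ts; rewrite /tr_src /= => /code_elt_inj ->.
  case=> t [X [l' [tD Xl Xt /mk_inj[-> <-] H]]].
  apply/hasP; exists (code_transition t); first by apply: map_f; rewrite mem_enum.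
  apply/hasP; exists X => //; rewrite /tr_src /tr_tgt /= Xt !eqxx /=.
  exact/match_viaP.
split=> [/andP[/Ebot b /orP[/base_viaP[y0 H]|/Erule r]]|[b [[_ y0 H]|r]]].
- by split=> //; left; split=> //; apply/b.
- by split=> //; right.
- by apply/andP; split; [apply/Ebot | apply/orP; left; apply/base_viaP].
- by apply/andP; split; [apply/Ebot | apply/orP; right; apply/Erule].
Qed.

End Sub.

Lemma path_via_mono T T' s w z : {subset T <= T'} ->
  path_via T s w z -> path_via T' s w z.
Proof.
move=> TT'; case: w => [|a [|b w]] //= /hasP[e eT H]; apply/hasP; exists e; auto.
move: H => /andP[-> /hasP[e' e'T H]]; apply/hasP; exists e'; auto.
Qed.

Lemma check_mono L bot' q' T T' : {subset T <= T'} ->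
  subpred (check D L bot' q' T) (check D L bot' q' T').
Proof.
move=> TT' e; rewrite /check => /andP[-> /orP[->|]] //= H; apply/orP; right.
apply: sub_has H => t; apply: sub_has => X /andP[->]; apply: sub_all => z.
by rewrite /match_via => /andP[->]; apply: path_via_mono.
Qed.

Definition saturation : seq data :=
  sat D (level Q n.-1) (cG bot) (code_elt q) U.

Lemma saturation_sub : {subset saturation <= U}.
Proof.
rewrite /saturation /sat; case: (size U) => // i e; rewrite iterS.
by rewrite mem_filter => /andP[].
Qed.

(** Derivations are built round by round: the premises of an edge are edges of the previous
    round. *)
Lemma saturation_sound x g y : edge_in saturation x g y ->
  exists m, der M q m x g y.
Proof.
rewrite /saturation /sat; elim: (size U) x g y => [//|i IH] x g y.
rewrite iterS; set T := iter i _ _.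
have TU : {subset T <= U}.
  by rewrite /T; case: (i) => // j e; rewrite iterS mem_filter => /andP[].
case/hasP=> e; rewrite mem_filter => /andP[ce /mem_universe[j [x' [g' [y' [jn x'j _ E]]]]]].
rewrite {e}E in ce * => /eqP/edge_inj[<- <- <-].
case/(checkP TU _ _ jn x'j): ce => _ [b|[t [X [l [tD Xl Xt -> H]]]]].
  by exists 1; constructor.
have /fin_all_exists[f Hf] (k : 'I_n) : exists m, pathd M q m (nth Leaf (preds X) k)
    (push t k) (target_of M g' y' l k).2.
  by have [_ /pathd_path_on] := H k; apply.
exists (\sum_k f k).+1; apply: (@DerRule _ _ _ _ _ _ t X) => // k.
by have [] := H k.
Qed.

Lemma saturation_typed x g y : edge_in saturation x g y -> exists i,
  [/\ i < n, x \in level Q i, y = Leaf \/ y \in level Q i & g = bot <-> y = Leaf].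
Proof.
case/hasP=> e eS; have /mem_universe[i [x' [g' [y' [ilt xi yi E]]]]] := saturation_sub eS.
rewrite {e}E in eS * => /eqP/edge_inj[<- <- <-]; exists i; split=> //.
move: eS; rewrite /saturation /sat -filter_fixpoint; last exact: check_mono.
by rewrite mem_filter => /andP[/(checkP saturation_sub _ _ ilt xi)[]].
Qed.

(** At the fixpoint, a candidate belongs to the saturation as soon as it passes the check against
    it. *)
Lemma saturation_closed i x g y : i < n -> x \in level Q i ->
  y = Leaf \/ y \in level Q i -> (g = bot <-> y = Leaf) ->
  base M q x g y \/ rule M (edge_in saturation) x g y -> edge_in saturation x g y.
Proof.
move=> ilt xi yi gy H.
apply/hasP; exists (entry (padding (cG bot) (n.-1 - i)) x (cG g) y); last exact: eqxx.
rewrite /saturation /sat -filter_fixpoint; last exact: check_mono.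
rewrite mem_filter; apply/andP; split; first exact/(checkP saturation_sub _ _ ilt xi).
by apply/mem_universe; exists i, x, g, y.
Qed.

End Check.

(** * The automaton *)

(** [code_set] follows the enumeration order of the type. Sums and products have to be enumerated
    explicitly so that this order can be compared with that of the nested folds. *)
Lemma enum_sumE (A B : finType) :
  enum {: A + B} = [seq inl x | x <- enum A] ++ [seq inr y | y <- enum B].
Proof. by rewrite [LHS]enumT Finite.enum.unlock /= /sum_enum -!enumT. Qed.

Lemma enum_prodE (A B : finType) :
  enum {: A * B} = [seq (x, y) | x <- enum A, y <- enum B].
Proof. by rewrite [LHS]enumT Finite.enum.unlock /=. Qed.

Lemma map_filter_flatten (T : Type) (h : T -> data) (p : pred T) s :
  [seq h t | t <- filter p s] = flatten [seq if p t then [:: h t] else [::] | t <- s].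
Proof. by elim: s => //= x s <-; case: (p x). Qed.

Lemma flatten_pairs (A B : Type) (F : A * B -> seq data) s1 s2 :
  flatten [seq F p | p <- [seq (x, y) | x <- s1, y <- s2]] =
  flatten [seq flatten [seq F (x, y) | y <- s2] | x <- s1].
Proof.
elim: s1 => //= x s1 IH; rewrite map_cat flatten_cat IH; congr (flatten _ ++ _).
by rewrite -map_comp.
Qed.

Lemma indexed_enum (T : finType) (f : T -> data) :
  indexed [seq f x | x <- enum T] = [seq Node (code_elt x) (f x) | x <- enum T].
Proof.
have H s : indexed s = [seq Node p.1 p.2 |
    p <- zip [seq code_nat i | i <- iota 0 (size s)] s].
  have -> : zip [seq code_nat i | i <- iota 0 (size s)] s =
      zip [seq code_nat i | i <- iota 0 (size s)]
          [seq nth Leaf s i | i <- iota 0 (size s)].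
    by rewrite map_nth_iota0 ?take_size.
  by rewrite zip_map2 -map_comp.
by rewrite H size_map -cardE -code_elt_enum zip_map2 -map_comp.
Qed.

Section Automaton.
Variables (n : nat) (Q S G : finType) (M : mpa n Q S G) (q : Q).
Hypotheses (n_gt0 : 0 < n) (M_nf : normal_form M).
Notation bot := (bot M).
Notation cG := (@code_elt G).
Let L0 := [seq mk p [::] | p <- enum Q].
Let Ls := level_list (cG bot) L0 n.-1 n.-1.
Let T := saturation M q.
Let R := @edge_in G T.

(** [Leaf] comes first, so the accepting state is [inr ord0]. *)
Definition extra_states : seq data := Leaf :: pairs Ls.

Notation E := 'I_(size extra_states).

(* A pair [Node u v] reads a stack from u, and remembers in v the predictions
   for the later stacks. *)
Definition state_data (s : Q + E) : data :=
  match s with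
  | inl p => Node Leaf (code_elt p)
  | inr j => nth Leaf extra_states j
  end.

Definition pre_automaton : m_automaton Q G E :=
  MAutomaton
    [set t : (Q + E) * G * (Q + E) |
      edge_via T (level Q n.-1) (state_data t.1.1) (cG t.1.2) (state_data t.2)]
    [set inr ord0].

Lemma aut_states_enum :
  aut_states Ls [seq code_nat i | i <- iota 0 #|Q|] =
  [seq state_data s | s <- enum {: Q + E}].
Proof.
rewrite enum_sumE map_cat /aut_states -code_elt_enum -map_comp -[X in _ = X ++ _]map_comp.
congr (_ ++ _); rewrite -[RHS]map_comp.
exact: (map_nth_ord Leaf (erefl (size extra_states))).
Qed.

Lemma code_deltaE :
  code_set (fun t : (Q + E) * G * (Q + E) =>
     code_record [:: code_elt t.1.1; cG t.1.2; code_elt t.2])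
    (aut_delta pre_automaton) =
  dlist (delta_list T (level Q n.-1)
    (aut_states Ls [seq code_nat i | i <- iota 0 #|Q|])
    [seq code_nat i | i <- iota 0 #|G|]).
Proof.
rewrite /code_set code_seqE; congr dlist.
rewrite aut_states_enum /delta_list indexed_enum -code_elt_enum.
rewrite {1}/enum_mem -enumT enum_prodE map_filter_flatten flatten_pairs enum_prodE.
rewrite flatten_pairs -map_comp; congr flatten; apply: eq_map => a /=.
rewrite -map_comp; congr flatten; apply: eq_map => g /=.
rewrite -map_comp; congr flatten; apply: eq_map => b /=.
by rewrite inE.
Qed.

Fixpoint acceptsD (a : data) (w : seq G) : Prop :=
  if w is g :: w' then
    exists b, [/\ exists s, b = state_data s, edge_via T (level Q n.-1) a (cG g) b &
                  acceptsD b w']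
  else a = Leaf.

Lemma mem_pairs b : b \in pairs Ls <-> exists i u v,
  [/\ i < n, u \in level Q i, v \in level Q i & b = Node u v].
Proof.
split=> [/flatten_mapP[lv /(mem_level_list M n_gt0)[i ilt ->]]|[i [u [v [ilt ui vi ->]]]]].
  by rewrite /= dlistK => /allpairsP[[u v] /= [ui vi ->]]; exists i, u, v.
apply/flatten_mapP; exists (Node (padding (cG bot) (n.-1 - i)) (dlist (level Q i))).
  by apply/(mem_level_list M n_gt0); exists i.
by rewrite /= dlistK; apply/allpairsP; exists (u, v).
Qed.

Lemma state_data_pair i u v : i < n -> u \in level Q i -> v \in level Q i ->
  exists s, Node u v = state_data s.
Proof.
move=> ilt ui vi; have H : Node u v \in extra_states.
  by rewrite inE; apply/orP; right; apply/mem_pairs; exists i, u, v.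
have lt : index (Node u v) extra_states < size extra_states by rewrite index_mem.
by exists (inr (Ordinal lt)); rewrite /= nth_index.
Qed.

Lemma state_data_final (s : Q + E) : s \in aut_final pre_automaton <-> state_data s = Leaf.
Proof.
rewrite inE; case: s => [p|j] /=; first by split=> // /eqP.
split=> [/eqP[->] //|H]; apply/eqP; congr inr; apply: val_inj => /=.
case: j H => -[|j] //= jlt H.
have : nth Leaf (pairs Ls) j \in pairs Ls by apply: mem_nth.
by rewrite H => /mem_pairs[? [? [? []]]].
Qed.

Lemma accepts_fromD s w : accepts_from pre_automaton s w <-> acceptsD (state_data s) w.
Proof.
elim: w s => [|g w IH] s /=; first exact: state_data_final.
split=> [[s']|[b [[s' ->] e /IH H]]]; last by exists s' => //; rewrite inE.
by rewrite inE => e /IH H; exists (state_data s'); split=> //; exists s'.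
Qed.

Definition next_state (y v : data) : data :=
  if y is Node _ _ then Node y v
  else if dsnd v is Node s l then Node s (Node (dfst v) l) else Leaf.

Lemma nextP u v g b : next_via T u v (cG g) b <->
  exists2 y, R u g y & b = next_state y v.
Proof.
split=> [/hasP[e eT /andP[/andP[/eqP eu /eqP eg] /eqP ->]]|[y /hasP[e eT /eqP Ee] ->]].
  exists (edge_tgt e); last by rewrite /next_state; case: (edge_tgt e).
  apply/hasP; exists e => //; rewrite -eu -eg.
  by have /(mem_universe M n_gt0)[i [x [g' [y [_ _ _ ->]]]]] := saturation_sub eT.
apply/hasP; exists e => //; move: Ee.
rewrite /edge_of /edge_src /edge_sym /edge_tgt => -> /=; rewrite !eqxx /=.
by rewrite /next_state; case: y.
Qed.

(** By induction on the stacks and, within each, on its letters. Since [bot] occurs only at the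
    bottom of a stack and labels exactly the edges into [Leaf], the automaton passes to the next
    prediction precisely at the boundary of two stacks. *)
Lemma acceptsD_pair i u (p : Q) l (ws : seq (seq G)) : i < n -> u \in level Q i ->
  mk p l \in level Q i -> size ws = i.+1 -> (forall w, w \in ws -> is_stack M w) ->
  acceptsD (Node u (mk p l)) (flatten ws) <->
  forall j, j < i.+1 -> path_on R (nth Leaf (u :: l) j) (nth [::] ws j) Leaf.
Proof.
elim: ws i u l => [|W ws IH] i u l //= ilt ui vi [sw] st.
have [w wb ->] : is_stack M W by apply: st; rewrite mem_head.
have [p' [l' [/mk_inj[_ <-] sl Hl]]] := level_inv vi.
have Eedge a g b : a \in level Q i ->
    edge_via T (level Q n.-1) (Node a (mk p l)) (cG g) b <->
    exists2 y, R a g y & b = next_state y (mk p l).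
  by move=> /level_inv[? [? [Ea _ _]]]; rewrite -nextP Ea.
have tR := saturation_typed n_gt0 (M := M) (q := q).
have leafst : exists s : Q + E, Leaf = state_data s by exists (inr ord0).
elim: w u ui wb => [|g w IHw] u ui wb /=.
  (* The situation once the bottom is read: either no stack remains, or the next one is read from
     the first prediction, one level below. *)
  have E1 : acceptsD (next_state Leaf (mk p l)) (flatten ws) <->
      forall j, j < i -> path_on R (nth Leaf l j) (nth [::] ws j) Leaf.
    case: i l ilt ui vi sw sl Hl {Eedge} => [|i] [|s l] //= ilt ui vi sw sl Hl.
      by case: ws sw {st IH} => //=.
    move: sl => [sl]; apply: (IH i) => //; first exact: ltnW.
    - exact: (Hl 0).
    - by apply: level_intro => // j ji; apply: (Hl j.+1).
    - by move=> w' w'ws; apply: st; rewrite inE w'ws orbT.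
  split=> [[b [_ /(Eedge _ _ _ ui)[y uy ->] H]] [|j] ji|H] /=.
  - have [_ [_ _ _ [/(_ erefl) y0 _]]] := tR _ _ _ uy.
    by exists Leaf => //; rewrite -y0.
  - have [_ [_ _ _ [/(_ erefl) y0 _]]] := tR _ _ _ uy.
    by apply: E1.1 => //; rewrite -y0.
  - exists (next_state Leaf (mk p l)); split.
    + case: (l) vi Hl sl => [|s lt] vi Hl sl; first exact: leafst.
      rewrite /next_state /=; apply: (state_data_pair (i := i.-1)).
      * by apply: leq_ltn_trans ilt; apply: leq_pred.
      * by have := Hl 0; rewrite subn0; apply; rewrite -sl.
      * apply: level_intro; first by rewrite -sl.
        move=> j ji; have := Hl j.+1; rewrite (_ : (i - j.+1).-1 = (i.-1 - j).-1).
          by apply; lia.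
        by rewrite subnS; lia.
    + by apply/Eedge => //; exists Leaf => //; have [m h <-] := H 0 isT.
    + by apply/E1 => j ji; apply: (H j.+1).
move: wb; rewrite inE negb_or => /andP[gb wb].
split=> [[b [_ /(Eedge _ _ _ ui)[y uy ->] H]]|H].
  have [i' [_ ui' yi' gy]] := tR _ _ _ uy.
  have E := level_size ui ui'; subst i'.
  case: yi' => [y0|yi']; first by move: gb; rewrite gy.2 // eqxx.
  have Ey : next_state y (mk p l) = Node y (mk p l).
    by rewrite /next_state; have [? [? [-> _ _]]] := level_inv yi'.
  rewrite Ey in H; have H' := (IHw y yi' wb).1 H.
  by case=> [_|j ji]; [exists y => //; apply: (H' 0) | apply: (H' j.+1)].
have [y uy yw] := H 0 isT.
have [i' [_ ui' yi' gy]] := tR _ _ _ uy.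
have E := level_size ui ui'; subst i'.
case: yi' => [y0|yi']; first by move: gb; rewrite gy.2 // eqxx.
have Ey : next_state y (mk p l) = Node y (mk p l).
  by rewrite /next_state; have [? [? [-> _ _]]] := level_inv yi'.
exists (Node y (mk p l)); split; first exact: state_data_pair ilt yi' vi.
  by apply/Eedge => //; exists y.
by apply/(IHw y yi' wb); case=> [_|j ji]; [| apply: (H j.+1)].
Qed.

(** An initial state has the outgoing edges of all pairs [Node X X] with its control state, so
    accepting from it amounts to choosing [X]. *)
Lemma aut_langP c : aut_lang pre_automaton M c <->
  pre_star M (fun c' => c' = empty_config M q) c.
Proof.
rewrite -(accepts_predsP n_gt0 (R := R)) //; first last.
- exact: saturation_closed.
- exact: saturation_typed.
- exact: saturation_sound.
have H (X : data) : is_config M c -> X \in level Q n.-1 ->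
    acceptsD (Node X X) (flatten c.2) <-> accepts_preds R X c.
  move=> cc Xl; have [p [l [EX sl _]]] := level_inv Xl.
  rewrite {2}EX (acceptsD_pair (i := n.-1)) //; first last.
  - by move=> w /tnthP[j ->]; apply: cc.
  - by rewrite size_tuple prednK.
  - by rewrite -EX.
  - by rewrite prednK.
  have EP : preds X = X :: l by rewrite /preds {2}EX /= dlistK.
  rewrite prednK // /accepts_preds EP; split=> H j.
    by have := H j (ltn_ord j); rewrite (tnth_nth [::]).
  by move=> jn; have := H (Ordinal jn); rewrite (tnth_nth [::]).
rewrite /aut_lang accepts_fromD; split=> -[cc] => [acc|[X [Xl Xc acc]]]; split=> //.
  case E: (flatten c.2) acc => [|g w] //= [b [sb /hasP[X Xl /andP[/eqP Xc e]] acc]].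
  exists X; split=> //; apply/H => //; rewrite E /=; exists b; split=> //.
  by move: e; have [? [? [-> _ _]]] := level_inv Xl.
move/(H X cc Xl): acc; have [p [l [EX _ _]]] := level_inv Xl.
case E: (flatten c.2) => [|g w] //= [b [sb e acc]]; exists b; split=> //.
apply/hasP; exists X => //; rewrite Xc eqxx.
by move: e; rewrite EX.
Qed.

End Automaton.

(** * Loop bounds *)

Fixpoint loop_free (e : lang) : bool :=
  match e with
  | V _ | N0 => true
  | C a b | Lt a b | Op OpAnd a b | Op OpOr a b => loop_free a && loop_free b
  | Cs a b c => [&& loop_free a, loop_free b & loop_free c]
  | _ => false
  end.

Lemma size_unlist d : size (unlist d) < dsize d.
Proof. by elim: d => //= x _ l IH; lia. Qed.

Lemma dsize_fst_snd d : dsize (dfst d) + dsize (dsnd d) <= (dsize d).+1.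
Proof. by case: d => //= x y; lia. Qed.

Lemma dsize_fst d : dsize (dfst d) <= dsize d.
Proof. by case: d => //= x y; lia. Qed.

Lemma dsize_snd d : dsize (dsnd d) <= dsize d.
Proof. by case: d => //= x y; lia. Qed.

Lemma dsize_mem d x : x \in unlist d -> dsize x <= dsize d.
Proof.
elim: d => //= y _ l IH; rewrite inE => /orP[/eqP ->|/IH]; lia.
Qed.

Lemma dsize_zip a b : dsize (zipd a b) < dsize a + dsize b.
Proof.
elim: a b => [|x _ a IH] [|y b] //=; try lia.
by have := IH b; lia.
Qed.

Lemma mem_zipd a b z : z \in unlist (zipd a b) ->
  dfst z \in unlist a /\ dsnd z \in unlist b.
Proof.
elim: a b => [|x _ a IH] [|y b] //=; rewrite !inE.
by case/orP=> [/eqP -> /=|/IH[-> ->]]; rewrite ?eqxx ?orbT.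
Qed.

Section Costs.
Variable B : nat.

Lemma ok_loop_free env e : loop_free e -> ok B env e.
Proof.
elim: e env => //= [a IHa b IHb|a IHa b IHb|a IHa b IHb c IHc|o a IHa b IHb] env.
- by case/andP=> /IHa ? /IHb ?.
- by case/andP=> /IHa ? /IHb ?.
- by case/and3P=> /IHa ? /IHb ? /IHc ?; split=> //; case: den.
- by case: o => // /andP[/IHa ? /IHb ?].
Qed.

Arguments ok : simpl never.

Lemma ok_Eq env a b : ok B env a -> ok B env b -> dsize (den env a) <= B ->
  ok B env (Eq a b).
Proof. by []. Qed.

Lemma ok_And env a b : ok B env a -> ok B env b -> ok B env (And a b).
Proof. by []. Qed.

(** Some bodies loop over their own accumulator or use it in tests; bounding these takes an
    invariant [I] between the accumulator and the tail already processed. *)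
Lemma ok_Fold env l i b (I : data -> data -> Prop) :
  ok B env l -> ok B env i -> size (unlist (den env l)) <= B ->
  I (den env i) Leaf ->
  (forall acc x tl, I acc tl -> size (unlist tl) < size (unlist (den env l)) ->
     x \in unlist (den env l) ->
     ok B (acc :: x :: tl :: env) b /\ I (den (acc :: x :: tl :: env) b) (Node x tl)) ->
  ok B env (Fold l i b).
Proof.
move=> ol oi sB Ii H; split=> //.
set F := fun acc x tl => _.
have : {subset unlist (den env l) <= unlist (den env l)} by [].
have : size (unlist (den env l)) <= size (unlist (den env l)) by [].
move: {1 3 5}(den env l) => d sd ssd.
suff [] : (fix okp (d : data) : Prop :=
          if d is Node x tl then
            okp tl /\ ok B (para F (den env i) tl :: x :: tl :: env) b
          else True) d /\ I (para F (den env i) d) d by [].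
elim: d sd ssd => [|x _ tl IH] //= sd ssd.
have [|x' x'tl|o1 I1] := IH; first exact: ltnW.
  by apply: ssd; rewrite inE x'tl orbT.
have [o2 I2] := H _ x _ I1 sd (ssd x (mem_head _ _)).
by [].
Qed.

Lemma ok_Fold_const env l i b :
  ok B env l -> ok B env i -> size (unlist (den env l)) <= B ->
  (forall acc x tl, x \in unlist (den env l) -> ok B (acc :: x :: tl :: env) b) ->
  ok B env (Fold l i b).
Proof.
move=> ol oi sB H; apply: (ok_Fold (I := fun _ _ => True)) => // acc x tl _ _ xl.
by split=> //; apply: H.
Qed.

Lemma ok_Fold_free env l i b :
  [&& loop_free l, loop_free i & loop_free b] -> size (unlist (den env l)) <= B ->
  ok B env (Fold l i b).
Proof.
by case/and3P=> ol oi ob sB; apply: ok_Fold_const => // *; apply: ok_loop_free.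
Qed.

Lemma ok_Fold_nest env l i b :
  loop_free l && loop_free i -> size (unlist (den env l)) <= B ->
  (forall acc x tl, x \in unlist (den env l) -> ok B (acc :: x :: tl :: env) b) ->
  ok B env (Fold l i b).
Proof. by case/andP=> ol oi; apply: ok_Fold_const; apply: ok_loop_free. Qed.

Lemma ok_Ex env l e : ok B env l -> size (unlist (den env l)) <= B ->
  (forall acc x tl, x \in unlist (den env l) -> ok B (acc :: x :: tl :: env) e) ->
  ok B env (Ex l e).
Proof. by move=> ol sl H; apply: ok_Fold_const => // acc x tl /H. Qed.

Lemma ok_All env l e : ok B env l -> size (unlist (den env l)) <= B ->
  (forall acc x tl, x \in unlist (den env l) -> ok B (acc :: x :: tl :: env) e) ->
  ok B env (All l e).
Proof. by move=> ol sl H; apply: ok_Fold_const => // acc x tl /H. Qed.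

(** * Bounds for the individual programs *)

Definition bounded (L : seq data) : Prop :=
  size L <= B /\ forall x, x \in L -> dsize x <= B.

Lemma dsize_edge e : dsize e <= B ->
  [/\ dsize (edge_of e) <= B, dsize (edge_src e) <= B, dsize (edge_sym e) <= B
    & dsize (edge_tgt e) <= B].
Proof.
move=> h; have h1 := leq_trans (dsize_fst e) h.
have h2 := leq_trans (dsize_snd _) h1.
split=> //; first exact: leq_trans (dsize_fst _) h1.
  exact: leq_trans (dsize_fst _) h2.
exact: leq_trans (dsize_snd _) h2.
Qed.

Lemma ok_path env s w z T : bounded (unlist T) -> dsize s <= B ->
  ok B [:: s, w, z, T & env] path_prog.
Proof.
move=> [sT dT] ds; split=> //; rewrite den_V /=; case: w => [|a w] //.
split=> //; rewrite den_V [nth _ _ _]/=; case: w => [|b w].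
  apply: ok_Ex => // acc e tl eT; apply: ok_Eq; try exact: ok_loop_free.
  by rewrite !denE; have [] := dsize_edge (dT e eT).
apply: ok_Ex => // acc e tl eT; have [h1 h2 h3 h4] := dsize_edge (dT e eT).
apply: ok_And.
  by apply: ok_And; apply: ok_Eq; try exact: ok_loop_free; rewrite !denE.
apply: ok_Ex => // acc' e' tl' e'T; apply: ok_Eq; try exact: ok_loop_free.
by rewrite !denE; have [] := dsize_edge (dT e' e'T).
Qed.

Lemma ok_check env e T D L bot q : 2 < B -> dsize e <= B -> bounded (unlist T) ->
  bounded (unlist D) -> bounded (unlist L) ->
  ok B [:: e, T, D, L, bot, q & env] check_prog.
Proof.
move=> B0 de bT [sD dD] [sL dL]; have [h1 h2 h3 h4] := dsize_edge de.
do 4 (split; first exact: ok_loop_free); rewrite !(den_Fst, den_Snd, den_V) /=.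
split=> //; first split=> //.
  (* The outer test compares two booleans, whose codes have size at most 3. *)
  by rewrite den_Op !denE /=; case: eqP => //= _; lia.
split=> //; first split=> //.
  split; first by apply: ok_loop_free.
  rewrite den_Snd den_V [nth _ _ _]/=; case Ez: (dsnd _) => [|z l];
    apply: ok_Eq; try exact: ok_loop_free; rewrite !denE.
    exact: leq_trans (dsize_fst _) h2.
  have := leq_trans (dsize_snd _) h2; rewrite /edge_src Ez; apply: leq_trans.
  exact: dsize_fst (Node z l).
apply: ok_Ex => // acc t tl tD; apply: ok_Ex => // acc1 X tl1 XL.
have dt := dD t tD; have dX := dL X XL.
apply: ok_And.
  apply: ok_And; apply: ok_Eq; try exact: ok_loop_free; rewrite !denE /=.
    exact: leq_trans (dsize_fst _) dt.
  apply: leq_trans (dsize_fst _) _; do 3 apply: leq_trans (dsize_snd _) _; exact: dt.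
(* Pops and pushes are disjoint parts of [t], so their zip is no larger than [t]. *)
have dz : dsize (zipd (tr_pops t) (tr_pushes t)) <= B.
  have := dsize_zip (tr_pops t) (tr_pushes t).
  have := dsize_fst_snd (dsnd t); have := dsize_snd t.
  have := dsize_fst (dsnd (dsnd (dsnd (dsnd t)))).
  have := dsize_snd (dsnd (dsnd (dsnd t))); have := dsize_snd (dsnd (dsnd t)).
  by rewrite /tr_pops /tr_pushes; lia.
have dp : dsize (tr_pops t) <= B.
  by apply: leq_trans (dsize_fst _) _; apply: leq_trans (dsize_snd _) _.
have dtau : dsize (dsnd e) <= B by apply: leq_trans (dsize_snd _) de.
apply: ok_All.
- by split; [split=> //; exact: ok_loop_free | split=> //; exact: ok_loop_free |];
    rewrite !denE.
- rewrite !denE /= unlist_zipd size_map size_zip; apply: leq_trans (geq_minl _ _) _.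
  exact: leq_trans (ltnW (size_unlist _)) dz.
move=> acc2 z tl2; rewrite !denE /= => /mem_zipd[/mem_zipd[zp _] /mem_zipd[_ zs]].
apply: ok_And.
  apply: ok_Eq; try exact: ok_loop_free; rewrite !denE /=.
  exact: leq_trans (dsize_mem zp) dp.
do 4 (split; first exact: ok_loop_free); rewrite !(den_Fst, den_Snd, den_V) /=.
apply: ok_path => //; move: zs; rewrite /= inE => /orP[/eqP -> //|/dsize_mem].
by move=> h; apply: leq_trans h (leq_trans (dsize_snd _) dX).
Qed.

Lemma size_code_nat k : size (unlist (code_nat k)) = k.
Proof. by elim: k => //= k ->. Qed.

Lemma ok_range env k : k <= B -> ok B (code_nat k :: env) range_prog.
Proof.
move=> kB; apply: (ok_Fold (I := fun acc tl => size (unlist acc) = size (unlist tl))) => //.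
  by rewrite den_V /= size_code_nat.
move=> acc x tl; rewrite den_V /= size_code_nat => E tlk _; split; last first.
  rewrite (@den_map _ _ _ _ (Node Leaf)) // !denE /= dlistK cats0.
  by rewrite size_map E.
split=> //; apply: ok_Fold_free => //; rewrite den_V /= E; lia.
Qed.

Lemma ok_extend env L : size L <= B -> ok B (dlist L :: env) extend_prog.
Proof.
move=> sL; apply: ok_Fold_nest => //; first by rewrite den_V /= dlistK.
by move=> acc x tl _; apply: ok_Fold_free => //; rewrite den_V /= dlistK.
Qed.

Lemma ok_levels env n L bot : n <= B ->
  (forall i, i <= n -> size (iter i extend L) <= B) ->
  ok B [:: code_nat n.+1, dlist L, bot & env] levels_prog.
Proof.
move=> nB sB; have sn : size (unlist (den [:: code_nat n.+1, dlist L, bot & env] (Snd (V 0)))) = n.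
  by rewrite !denE /= size_code_nat.
apply: (ok_Fold (I := fun acc tl => acc = dlist (level_list bot L n (size (unlist tl))))).
- exact: ok_loop_free.
- by do 2 (split=> //); apply: ok_Fold_free => //; rewrite sn.
- by rewrite sn.
- exact: den_levels_init.
move=> acc x tl ->; rewrite sn => tln _; split; last exact: den_level_body.
split=> //; split; first exact: ok_loop_free.
split; first exact: ok_loop_free.
have [s E] := level_list_head bot L n (size (unlist tl)).
by rewrite !denE E /=; apply: ok_extend; apply: sB; apply: ltnW.
Qed.

Lemma ok_universe env Ls gs : size Ls <= B -> size gs <= B ->
  (forall lv, lv \in Ls -> size (unlist (dfst lv)) <= B /\
     size (unlist (dsnd lv)) < B) ->
  (forall lv x, lv \in Ls -> x \in unlist (dsnd lv) -> size (unlist (dsnd x)) <= B) ->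
  ok B [:: dlist Ls, dlist gs & env] universe_prog.
Proof.
move=> sL sg HL Hx.
apply: ok_Fold_nest => //; first by rewrite den_V /= dlistK.
move=> acc lv tl; rewrite den_V /= dlistK => lvL; have [h1 h2] := HL lv lvL.
apply: ok_Fold_nest => //; first by rewrite !denE; apply: ltnW.
move=> acc1 x tl1; rewrite !denE /= => /(Hx _ _ lvL) sx.
apply: ok_Fold_nest => //; first by rewrite den_V /= dlistK.
move=> acc2 g tl2 _; apply: ok_Fold_nest => //.
move=> acc3 y tl3 _; split=> //; split=> //.
apply: ok_Fold_const; [exact: ok_loop_free | | by rewrite !denE |].
  by split; [exact: ok_loop_free | apply: ok_Fold_free => //; rewrite !denE].
by move=> *; apply: ok_loop_free.
Qed.

Lemma ok_sat env U D L bot q : 2 < B -> bounded (unlist U) -> bounded (unlist D) ->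
  bounded (unlist L) -> ok B [:: U, D, L, bot, q & env] sat_prog.
Proof.
move=> B0 [sU dU] bD bL.
apply: (ok_Fold (I := fun T _ => bounded (unlist T))) => //.
move=> T x tl bT _ _; split; last first.
  rewrite den_sat_round dlistK; split; last first.
    by move=> e; rewrite mem_filter => /andP[_ /dU].
  by apply: leq_trans sU; rewrite size_filter count_size.
apply: ok_Fold_nest => // acc e tl' eU; split.
  do 6 (split; first by []); rewrite !den_V /=.
  by apply: ok_check => //; apply: dU.
by case: den.
Qed.

Lemma ok_states env Ls qs : size Ls <= B -> size qs <= B ->
  (forall lv, lv \in Ls -> size (unlist (dsnd lv)) <= B) ->
  ok B [:: dlist Ls, dlist qs & env] states_prog.
Proof.
move=> sL sq HL; apply: ok_Fold_const => //.
- split=> //; apply: ok_Fold_nest => //; first by rewrite den_V /= dlistK.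
  move=> acc lv tl; rewrite den_V /= dlistK => /HL slv.
  apply: ok_Fold_nest => //; rewrite !denE //=.
  by move=> acc1 u tl1 _; apply: ok_Fold_free => //; rewrite !denE.
- by rewrite den_V /= dlistK.
Qed.

Lemma ok_index env L : size L <= B -> ok B (dlist L :: env) index_prog.
Proof.
move=> sL; apply: (ok_Fold (I := fun acc tl => size (unlist acc) = size (unlist tl))) => //.
  by rewrite den_V /= dlistK.
move=> acc x tl E; rewrite den_V /= dlistK => tlL _; split.
  split; first exact: ok_loop_free.
  by apply: ok_Fold_free => //; rewrite den_V /= E; lia.
rewrite /= (@den_map _ _ _ _ (fun p => Node (Node Leaf (dfst p)) (dsnd p))) //.
by rewrite !denE /= dlistK cats0 size_map E.
Qed.

Lemma ok_next env u v g b T : bounded (unlist T) -> dsize b <= B ->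
  ok B [:: u, v, g, b, T & env] next_prog.
Proof.
move=> [sT dT] db; apply: ok_Ex => // acc e tl eT.
have [h1 h2 h3 h4] := dsize_edge (dT e eT).
apply: ok_And.
  by apply: ok_And; apply: ok_Eq; try exact: ok_loop_free; rewrite !denE.
split; first exact: ok_loop_free.
by case: den => [|y1 y2]; apply: ok_Eq; try exact: ok_loop_free; rewrite !denE.
Qed.

Lemma ok_edge env a g b T L : bounded (unlist T) -> bounded (unlist L) ->
  dsize b <= B -> ok B [:: a, g, b, T, L & env] edge_prog.
Proof.
move=> bT [sL dL] db; split=> //; rewrite den_V /=; case: a => [|u v] //.
split=> //; rewrite den_V [nth _ _ _]/=; case: u => [|u1 u2].
  apply: ok_Ex => // acc X tl XL; apply: ok_And.
    apply: ok_Eq; try exact: ok_loop_free; rewrite !denE.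
    by apply: leq_trans (dsize_fst _) _; apply: dL.
  by do 5 (split; first by []); rewrite !den_V /=; apply: ok_next.
by do 5 (split; first by []); rewrite !den_V /=; apply: ok_next.
Qed.

Lemma ok_delta env A gs T L : bounded A -> size gs <= B -> bounded T -> bounded L ->
  ok B [:: dlist (indexed A), dlist gs, dlist T, dlist L & env] delta_prog.
Proof.
move=> [sA dA] sg bT bL.
have sI : size (indexed A) <= B by rewrite size_map size_iota.
apply: ok_Fold_nest => //; first by rewrite den_V /= dlistK.
move=> acc a tl _; apply: ok_Fold_nest => //; first by rewrite den_V /= dlistK.
move=> acc1 g tl1 _; apply: ok_Fold_nest => //; first by rewrite den_V /= dlistK.
move=> acc2 b tl2; rewrite den_V /= dlistK => bI; split.
  do 5 (split; first exact: ok_loop_free); rewrite !(den_Fst, den_Snd, den_V) /=.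
  apply: ok_edge; rewrite ?dlistK //.
  case/mapP: bI => i; rewrite mem_iota => /andP[_ iA] -> /=.
  by apply: dA; apply: mem_nth.
by case: den => [|? ?]; apply: ok_loop_free.
Qed.

End Costs.

(** * Sizes and running time *)

Lemma dsize_code_nat k : dsize (code_nat k) = (2 * k).+1.
Proof. by elim: k => //= k ->; lia. Qed.

Lemma dsize_code_elt (T : finType) (x : T) : dsize (code_elt x) < 2 * #|T|.
Proof. by rewrite dsize_code_nat; have : enum_rank x < #|T| := ltn_ord _; lia. Qed.

Lemma code_elt_le (T : finType) (x : T) c :
  #|T| <= c -> dsize (code_elt x) < 2 * c.
Proof. by move=> Tc; apply: leq_trans (dsize_code_elt x) _; rewrite leq_mul2l. Qed.

Lemma dsize_dlist l c : (forall x, x \in l -> dsize x <= c) ->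
  dsize (dlist l) <= size l * c.+1 + 1.
Proof.
elim: l => //= x l IH H; have := H x (mem_head _ _).
have : dsize (dlist l) <= size l * c.+1 + 1.
  by apply: IH => y yl; apply: H; rewrite inE yl orbT.
by rewrite mulSn; lia.
Qed.

Lemma size_flatten_le (T : eqType) (f : T -> seq data) s c :
  (forall x, x \in s -> size (f x) <= c) ->
  size (flatten [seq f x | x <- s]) <= size s * c.
Proof.
elim: s => //= x s IH H; rewrite size_cat mulSn leq_add //.
  exact/H/mem_head.
by apply: IH => y ys; apply: H; rewrite inE ys orbT.
Qed.

Lemma code_elt_sum (A B : finType) :
  [seq code_elt (inl x : A + B) | x <- enum A] = [seq code_nat i | i <- iota 0 #|A|] /\
  [seq code_elt (inr y : A + B) | y <- enum B] = [seq code_nat i | i <- iota #|A| #|B|].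
Proof.
have := code_elt_enum (A + B)%type; rewrite enum_sumE card_sum iotaD !map_cat.
rewrite -[X in X ++ _ = _]map_comp -[X in _ ++ X = _]map_comp => /eqP.
rewrite eqseq_cat; last by rewrite size_map -cardE size_map size_iota.
by case/andP=> /eqP -> /eqP ->.
Qed.

Section Main.
Variables (n : nat) (Q S G : finType) (M : mpa n Q S G) (q : Q).
Hypothesis n_gt0 : 0 < n.
Notation cb := (code_elt (bot M)).
Let m := mpa_size M.
Let N := m ^ (2 ^ n).
Let L0 := [seq mk p [::] | p <- enum Q].
Let Ls := level_list cb L0 n.-1 n.-1.
Let qs := [seq code_nat i | i <- iota 0 #|Q|].
Let gs := [seq code_nat i | i <- iota 0 #|G|].
Let D := [seq code_transition t | t <- enum (delta M)].
Let U := universe Ls gs.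
Let A := aut_states Ls qs.

(** The start symbol differs from [bot], so there are two stack symbols; one stack and one state
    make 4. *)
Lemma m_bounds : [/\ n <= m, #|Q| <= m, #|G| <= m, #|delta M| <= m & 4 <= m].
Proof.
rewrite /m /mpa_size.
have Q0 : 0 < #|Q| by apply/card_gt0P; exists q.
have G1 : 1 < #|G|.
  rewrite (cardD1 (bot M)) ltnS lt0n; apply/pred0Pn; exists (start_symbol M).
  by rewrite !inE andbT; apply/eqP; apply: start_symbol_neq_bot.
split; lia.
Qed.

Lemma N_ge : m * m <= N.
Proof.
have [_ _ _ _ m4] := m_bounds.
rewrite mulnn /N leq_pexp2l //; first lia.
by rewrite -{1}(expn1 2) leq_pexp2l.
Qed.

(** With these inequalities the size estimates become linear in the powers of N, each of which
    absorbs constants of the previous one. *)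
Lemma N_powers : [/\ 16 <= N, 16 * N <= N ^ 2, 16 * N ^ 2 <= N ^ 3 &
  [/\ 16 * N ^ 3 <= N ^ 4, 16 * N ^ 4 <= N ^ 5 & 16 * N ^ 5 <= N ^ 6]].
Proof.
have [_ _ _ _ m4] := m_bounds.
have N16 : 16 <= N by apply: leq_trans N_ge; apply: (@leq_mul 4 4).
by rewrite -{2}(expn1 N) !(expnS N) !leq_mul.
Qed.

Lemma size_level i : size (level Q i) = #|Q| ^ (2 ^ i).
Proof.
elim: i => [|i IH]; first by rewrite size_map -cardE expn0 expn1.
by rewrite /level iterS -/(level Q i) size_allpairs IH expnSr expnM mulnn.
Qed.

Lemma size_level_le i : i <= n -> size (level Q i) <= N.
Proof.
have [_ Qm _ _ m4] := m_bounds.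
move=> ilt; rewrite size_level.
apply: (@leq_trans (m ^ 2 ^ i)); first by rewrite leq_exp2r ?expn_gt0.
by rewrite leq_pexp2l ?leq_pexp2l //; lia.
Qed.

Lemma dsize_level i x : i <= n -> x \in level Q i -> dsize x <= N ^ 2.
Proof.
have [_ Qm _ _ m4] := m_bounds.
(* The successor of the size is additive: adding the prediction y to v gives the sum of the two
   values, so the bound doubles with each level. *)
move=> ilt xi; have : (dsize x).+1 <= 2 ^ i * (2 * m + 4).
  elim: i x {ilt} xi => [|i IH] x.
    by case/mapP=> p _ ->; have := code_elt_le p Qm; rewrite /= expn0; lia.
  case/allpairsP=> -[y v] /= [/IH h1 vi ->]; rewrite expnS -mulnA.
  move: (IH v vi) h1; have [p [l [-> _ _]]] := level_inv vi.
  by rewrite /=; lia.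
have h1 : 2 ^ i <= N.
  apply: (@leq_trans (2 ^ 2 ^ n)); last by rewrite leq_exp2r ?expn_gt0 //; lia.
  by rewrite leq_exp2l // (leq_trans ilt) // ltnW // ltn_expl.
have h2 : 2 * m + 4 <= N by apply: leq_trans N_ge; nia.
by have := leq_mul h1 h2; rewrite mulnn; lia.
Qed.

Lemma level_listP lv : lv \in Ls -> exists2 i, i < n &
  lv = Node (padding cb (n.-1 - i)) (dlist (level Q i)).
Proof. by move/(mem_level_list M n_gt0). Qed.

Lemma size_Ls : size Ls = n.
Proof.
have H k i : size (level_list cb L0 k i) = i.+1 by elim: i => //= i ->.
by rewrite /Ls H prednK.
Qed.

(** There are n levels, and at most N sources, m symbols and [N.+1] targets in each. The sixth power
    is the common bound for all loops of the program. *)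
Lemma size_universe : size U <= N ^ 6.
Proof.
have [nm _ Gm _ m4] := m_bounds; have [N16 N2 N3 [N4 N5 N6]] := N_powers.
have mN : m <= N by apply: leq_trans N_ge; nia.
have H : size U <= size Ls * (N * (m * N.+1)).
  apply: size_flatten_le => lv /level_listP[i ilt ->].
  rewrite [dsnd _]/= dlistK; have sl := size_level_le (ltnW ilt).
  apply: leq_trans (leq_mul sl (leqnn _)); apply: size_flatten_le => x _.
  have sg : size gs <= m by rewrite size_map size_iota.
  apply: leq_trans (leq_mul sg (leqnn _)); apply: size_flatten_le => g _.
  by rewrite size_map /= ltnS.
apply: leq_trans H _; rewrite size_Ls.
have := leq_mul (leq_trans nm mN) (leq_mul (leqnn N) (leq_mul mN (leqnn N.+1))).
move/leq_trans; apply; rewrite (_ : N * _ = N ^ 3 * N.+1); last by rewrite !expnS expn0; lia.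
by rewrite mulnS -expnSr; lia.
Qed.

Lemma bounded_universe : bounded (N ^ 6) U.
Proof.
have [nm _ Gm _ m4] := m_bounds; have [N16 N2 N3 [N4 N5 N6]] := N_powers.
have mN : m <= N by apply: leq_trans N_ge; nia.
split=> [|e]; first exact: size_universe.
rewrite /U /gs -code_elt_enum => /(mem_universe M n_gt0)[i [x [g [y [ilt xi yi ->]]]]].
have dx := dsize_level (ltnW ilt) xi.
have dy : dsize y <= N ^ 2.
  by case: yi => [->|yi]; [rewrite /=; lia | exact: dsize_level (ltnW ilt) yi].
have [p [l [Ex sl Hl]]] := level_inv xi.
have dg := code_elt_le g Gm; have db := code_elt_le (bot M) Gm.
have Htau : dsize (dsnd (entry (padding cb (n.-1 - i)) x (code_elt g) y)) <=
    n * (2 * N ^ 2).+1 + 1.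
  rewrite /entry [dsnd _]/= /padding dlistK Ex /= dlistK.
  set s := _ ++ _; have <- : size s = n.
    by rewrite size_cat size_nseq /= size_map sl; lia.
  apply: dsize_dlist => z; rewrite mem_cat inE.
  case/or3P=> [/nseqP[-> _]|/eqP ->|/mapP[z' z'l ->]] /=; try lia.
  have jl : index z' l < i by rewrite -sl index_mem.
  have := Hl _ jl; rewrite nth_index // => /dsize_level h.
  by have := h _; move=> /(_ ltac:(lia)); lia.
have h : n * (2 * N ^ 2).+1 <= N + 2 * N ^ 3.
  rewrite (expnS N 2) mulnCA -mulnS; apply: leq_mul => //; exact: leq_trans nm mN.
move: Htau; rewrite /entry /= => Htau; lia.
Qed.

Lemma bounded_level : bounded (N ^ 6) (level Q n.-1).
Proof.
have [N16 N2 N3 [N4 N5 N6]] := N_powers; have ln : n.-1 <= n by lia.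
split=> [|x /(dsize_level ln)]; last lia.
by have := size_level_le ln; lia.
Qed.

Lemma bounded_delta : bounded (N ^ 6) D.
Proof.
have [nm Qm Gm Dm m4] := m_bounds; have [N16 N2 N3 [N4 N5 N6]] := N_powers.
have mN : m <= N by apply: leq_trans N_ge; nia.
have Sm : #|S| <= m by rewrite /m /mpa_size; lia.
split=> [|_ /mapP[t _ ->]]; first by rewrite size_map -cardE; lia.
have nN : n * (5 * m) <= 5 * N by have := N_ge; have := leq_mul nm (leqnn (5 * m)); lia.
have opt (T : finType) (o : option T) : #|T| <= m -> dsize (code_option (@code_elt T) o) <= 2 * m + 2.
  by case: o => [x|] /= Tm; [have := code_elt_le x Tm; lia | lia].
have h1 : dsize (code_elt (source t)) <= 2 * m by have := code_elt_le (source t) Qm; lia.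
have h2 : dsize (code_elt (target t)) <= 2 * m by have := code_elt_le (target t) Qm; lia.
have h3 := opt S (label t) Sm.
have h4 : dsize (code_seq (code_option (@code_elt G)) [seq pop t i | i <- enum 'I_n]) <= 5 * N + 1.
  rewrite code_seqE; have := @dsize_dlist
    [seq code_option (@code_elt G) x | x <- [seq pop t i | i <- enum 'I_n]] (2 * m + 2).
  rewrite size_map size_map size_enum_ord => h; apply: leq_trans (h _) _.
    by move=> _ /mapP[o _ ->]; apply: opt.
  by have := leq_mul (leqnn n) (_ : (2 * m + 2).+1 <= 5 * m); move=> /(_ ltac:(lia)); lia.
have h5 : dsize (code_seq (code_seq (@code_elt G)) [seq push t i | i <- enum 'I_n]) <= 10 * N + 1.
  rewrite code_seqE; have := @dsize_dlist
    [seq code_seq (@code_elt G) x | x <- [seq push t i | i <- enum 'I_n]]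
    (2 * (2 * m).+1 + 1).
  rewrite size_map size_map size_enum_ord => h; apply: leq_trans (h _) _.
    move=> _ /mapP[w /mapP[i _ ->] ->].
    have := @dsize_dlist [seq code_elt x | x <- push t i] (2 * m).
    rewrite -code_seqE size_map => h'; apply: leq_trans (h' _) _.
      by move=> _ /mapP[x _ ->]; have := code_elt_le x Gm; lia.
    by rewrite leq_add2r leq_mul // size_bseq.
  have := leq_mul (leqnn n) (_ : (2 * (2 * m).+1 + 1).+1 <= 10 * m); move=> /(_ ltac:(lia)); lia.
rewrite /code_transition /code_record.
move: h1 h2 h3 h4 h5; rewrite /=; lia.
Qed.

Lemma bounded_states : bounded (N ^ 5) A.
Proof.
have [nm Qm Gm Dm m4] := m_bounds; have [N16 N2 N3 [N4 N5 N6]] := N_powers.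
have mN : m <= N by apply: leq_trans N_ge; nia.
split=> [|x].
  rewrite size_cat !size_map size_iota /=.
  have H : size (pairs Ls) <= size Ls * (N * N).
    apply: size_flatten_le => lv /level_listP[i ilt ->].
    have sl := size_level_le (ltnW ilt).
    by rewrite size_allpairs [dsnd _]/= dlistK leq_mul.
  have : size Ls * (N * N) <= N ^ 3.
    by rewrite size_Ls !expnS expn0 muln1 leq_mul // (leq_trans nm mN).
  move=> h; apply: leq_trans (leq_add Qm (leqnn _)) _; lia.
rewrite mem_cat inE => /or3P[/mapP[p pq ->]|/eqP ->|]; rewrite /=; try lia.
  move: pq; rewrite /qs -code_elt_enum => /mapP[p' _ ->].
  by have := code_elt_le p' Qm; lia.
case/(mem_pairs M n_gt0)=> i [u [v [ilt ui vi ->]]] /=.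
have := dsize_level (ltnW ilt) ui; have := dsize_level (ltnW ilt) vi; lia.
Qed.

Let inp := code_input M q.

Lemma den_Lt_eq {env a b v} : den env a = v -> den env (Lt a b) = den (v :: env) b.
Proof. by move=> <-. Qed.

Lemma ok_Lt_eq {B env a b v} : den env a = v -> ok B env a -> ok B (v :: env) b ->
  ok B env (Lt a b).
Proof. by move=> <-. Qed.

Lemma L0E : dlist [seq Node x Leaf | x <- qs] = dlist L0.
Proof. by rewrite /qs -code_elt_enum -map_comp. Qed.

Lemma level_Ls : dsnd (dfst (dlist Ls)) = dlist (level Q n.-1).
Proof. by rewrite /Ls; have [s ->] := level_list_head cb L0 n.-1 n.-1. Qed.

Lemma den_gs : den [:: inp] (Lt (Fst (Snd (Snd (Snd (Fst (V 0)))))) range_prog) =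
  dlist gs.
Proof. exact: den_range. Qed.

Lemma den_qs : den [:: dlist gs; inp] (Lt (Fst (Snd (Fst (V 1)))) range_prog) =
  dlist qs.
Proof. exact: den_range. Qed.

Let env2 := [:: dlist qs; dlist gs; inp].
Let levels_call :=
  Lt (Fst (Snd (Snd (Snd (Snd (Fst (V 2)))))))
    (Lt (Fold (V 1) N0 (C (C (V 1) N0) (V 0)))
      (Lt (Fst (Fst (V 4))) levels_prog)).

Lemma den_L0 env : den [:: cb, dlist qs & env] (Fold (V 1) N0 (C (C (V 1) N0) (V 0))) =
  dlist L0.
Proof.
by rewrite -L0E (@den_map _ _ _ _ (fun x => Node x Leaf)) // !denE /= dlistK cats0.
Qed.

Lemma den_Ls : den env2 levels_call = dlist Ls.
Proof.
rewrite (@den_Lt_eq _ _ _ (cb)) // (@den_Lt_eq _ _ _ (dlist L0)); last exact: den_L0.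
rewrite (@den_Lt_eq _ _ _ (code_nat n.-1.+1)); last by rewrite prednK.
exact: den_levels.
Qed.

Let env3 := dlist Ls :: env2.
Let sat_call :=
  Lt (Fst (Snd (V 3)))
    (Lt (Fst (Snd (Snd (Snd (Snd (Fst (V 4)))))))
      (Lt (Snd (Fst (V 2)))
        (Lt (Fst (Snd (Snd (Snd (Snd (Snd (Fst (V 6))))))))
          (Lt (Lt (V 6) (Lt (V 5) universe_prog)) sat_prog)))).

Let T := saturation M q.

Lemma DE : code_set (@code_transition n Q S G) (delta M) = dlist D.
Proof. exact: code_seqE. Qed.

Lemma den_U env : den [:: dlist D, dlist (level Q n.-1), cb, code_elt q & env3 ++ env]
    (Lt (V 6) (Lt (V 5) universe_prog)) = dlist U.
Proof. exact: den_universe. Qed.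

Lemma den_T : den env3 sat_call = dlist T.
Proof.
rewrite (@den_Lt_eq _ _ _ (code_elt q)) // (@den_Lt_eq _ _ _ (cb)) //.
rewrite (@den_Lt_eq _ _ _ (dlist (level Q n.-1))); last by rewrite -level_Ls.
rewrite (@den_Lt_eq _ _ _ (dlist D)); last by rewrite -DE.
rewrite (@den_Lt_eq _ _ _ (dlist U)); last by rewrite -(cats0 env3) den_U.
by rewrite den_sat !dlistK /T /saturation /U /gs -code_elt_enum.
Qed.

Let env4 := dlist T :: env3.
Let states_call := Lt (V 2) (Lt (V 2) states_prog).

Lemma den_A : den env4 states_call = dlist A.
Proof. exact: den_states. Qed.

Let env5 := dlist A :: env4.
Let delta_call :=
  Lt (Snd (Fst (V 2))) (Lt (V 2) (Lt (V 6) (Lt (Lt (V 3) index_prog) delta_prog))).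

Lemma den_delta_call : den env5 delta_call = dlist (delta_list T (level Q n.-1) A gs).
Proof.
rewrite (@den_Lt_eq _ _ _ (dlist (level Q n.-1))); last by rewrite -level_Ls.
rewrite (@den_Lt_eq _ _ _ (dlist T)) // (@den_Lt_eq _ _ _ (dlist gs)) //.
rewrite (@den_Lt_eq _ _ _ (dlist (indexed A))); last exact: den_index.
exact: den_delta.
Qed.

Lemma den_count env l : den (dlist l :: env) (Fold (V 0) N0 (C N0 (V 0))) =
  code_nat (size l).
Proof. by rewrite den_Fold den_V den_N0 [nth _ _ _]/=; elim: {2 3}l => //= x l' ->. Qed.

Lemma card_states : #|{: Q + 'I_(size (extra_states M))}| = size A.
Proof. by rewrite /A aut_states_enum size_map -cardE. Qed.

Lemma den_main : den [:: inp] main_prog = code_automaton (pre_automaton M q).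
Proof.
rewrite /main_prog (den_Lt_eq den_gs) (den_Lt_eq den_qs) (den_Lt_eq den_Ls).
rewrite (den_Lt_eq den_T) (den_Lt_eq den_A) !den_C den_count den_delta_call.
rewrite /code_automaton card_states code_deltaE //.
rewrite /code_set enum_set1; have [E1 E2] := code_elt_sum Q 'I_(size (extra_states M)).
congr (Node _ (Node _ (Node _ (Node _ _)))).
  by rewrite [RHS]code_seqE; exact: (congr1 (dlist) (esym E1)).
by move: E2; rewrite enum_ordSl card_ord /= => -[->].
Qed.

Lemma ok_main : ok (N ^ 6) [:: inp] main_prog.
Proof.
have [nm Qm Gm Dm m4] := m_bounds; have [N16 N2 N3 [N4 N5 N6]] := N_powers.
have mN : m <= N by apply: leq_trans N_ge; nia.
have nB : n <= N ^ 6 by lia.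
have QB : #|Q| <= N ^ 6 by apply: leq_trans Qm _; lia.
have GB : #|G| <= N ^ 6 by apply: leq_trans Gm _; lia.
have sgs : size gs <= N ^ 6 by rewrite size_map size_iota.
have sqs : size qs <= N ^ 6 by rewrite size_map size_iota.
have sLs : size Ls <= N ^ 6 by rewrite size_Ls.
have bU := bounded_universe; have bD := bounded_delta; have bL := bounded_level.
have bA : bounded (N ^ 6) A.
  by have [sA dA] := bounded_states; split=> [|x /dA]; lia.
have bT : bounded (N ^ 6) T.
  have sub : {subset T <= U} by rewrite /U /gs -code_elt_enum; apply: saturation_sub.
  split; last by move=> x /sub; apply: bU.2.
  have gen (p : seq data -> pred data) (V : seq data) k :
      size (iter k (fun s => filter (p s) V) [::]) <= size V.
    by case: k => //= k; rewrite size_filter count_size.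
  by apply: leq_trans bU.1; rewrite /U /gs -code_elt_enum; apply: gen.
have slev lv : lv \in Ls -> size (unlist (dsnd lv)) < N ^ 6.
  move=> /level_listP[i ilt ->]; rewrite [dsnd _]/= dlistK.
  by have := size_level_le (ltnW ilt); lia.
apply: (ok_Lt_eq den_gs).
  by split; [exact: ok_loop_free | apply: ok_range].
apply: (ok_Lt_eq den_qs).
  by split; [exact: ok_loop_free | apply: ok_range].
apply: (ok_Lt_eq den_Ls).
  apply: (@ok_Lt_eq _ _ _ _ (cb)); [by [] | exact: ok_loop_free |].
  apply: (ok_Lt_eq (den_L0 _)).
    by apply: ok_Fold_free => //; rewrite den_V /= dlistK.
  apply: (@ok_Lt_eq _ _ _ _ (code_nat n.-1.+1)).
  - by rewrite prednK.
  - exact: ok_loop_free.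
  - apply: ok_levels; first lia.
    by move=> i ilt; apply: leq_trans (size_level_le _) _; lia.
apply: (ok_Lt_eq den_T).
  apply: (@ok_Lt_eq _ _ _ _ (code_elt q)); [by [] | exact: ok_loop_free |].
  apply: (@ok_Lt_eq _ _ _ _ (cb)); [by [] | exact: ok_loop_free |].
  apply: (@ok_Lt_eq _ _ _ _ (dlist (level Q n.-1))); [by rewrite -level_Ls | exact: ok_loop_free |].
  apply: (@ok_Lt_eq _ _ _ _ (dlist D)); [by rewrite -DE | exact: ok_loop_free |].
  apply: (@ok_Lt_eq _ _ _ _ (dlist U)); first by rewrite -(cats0 env3) den_U.
    split; first exact: ok_loop_free.
    split; first exact: ok_loop_free.
    apply: ok_universe => //.
      move=> lv lvL; split; last exact: slev.
      have [i ilt ->] := level_listP lvL.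
      by rewrite /= /padding dlistK size_nseq; lia.
    move=> lv x /level_listP[i ilt ->]; rewrite [dsnd _]/= dlistK.
    by case/level_inv=> p [l [-> sl _]]; rewrite /= dlistK sl; lia.
  by apply: ok_sat; rewrite ?dlistK //; lia.
apply: (ok_Lt_eq den_A).
  split; first exact: ok_loop_free.
  split; first exact: ok_loop_free.
  by apply: ok_states => // lv /slev/ltnW.
split.
  by apply: ok_Fold_free => //; rewrite den_V /= dlistK; case: bA.
split; first exact: ok_loop_free.
split; last by split; exact: ok_loop_free.
apply: (@ok_Lt_eq _ _ _ _ (dlist (level Q n.-1))); [by rewrite -level_Ls | exact: ok_loop_free |].
apply: (@ok_Lt_eq _ _ _ _ (dlist T)); [by [] | by [] |].
apply: (@ok_Lt_eq _ _ _ _ (dlist gs)); [by [] | by [] |].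
apply: (@ok_Lt_eq _ _ _ _ (dlist (indexed A))); first exact: den_index.
  by split; [exact: ok_loop_free | apply: ok_index; case: bA].
exact: ok_delta.
Qed.

(** At most [N ^ 5] states and N symbols leave room for [N ^ 11] edges. *)
Lemma aut_size_le : aut_size (pre_automaton M q) <= N ^ 12.
Proof.
have [nm Qm Gm Dm m4] := m_bounds; have [N16 N2 N3 [N4 N5 N6]] := N_powers.
have mN : m <= N by apply: leq_trans N_ge; nia.
have GN := leq_trans Gm mN; have [A5 _] := bounded_states.
rewrite /aut_size card_states.
have := max_card (aut_delta (pre_automaton M q)).
rewrite !card_prod card_states => h.
have h2 : size A * #|G| * size A <= N ^ 11.
  by rewrite -[11]/(5 + 1 + 5) !expnD expn1 !leq_mul.
have h3 : N ^ 5 <= N ^ 11 by rewrite leq_pexp2l //; lia.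
have h4 : 16 * N ^ 11 <= N ^ 12 by rewrite (expnS N 11) leq_mul.
apply: leq_trans (leq_add (leq_add A5 GN) (leq_trans h h2)) _; lia.
Qed.

End Main.

(** A factor x in the exponent is at most [2 ^ (x * n)], so a polynomial in N is absorbed by the
    constant in front of n. *)
Lemma expn_tower m n x : 0 < m -> 0 < n -> (m ^ (2 ^ n)) ^ x <= m ^ (2 ^ (x.+1 * n)).
Proof.
move=> m0 n0; rewrite -expnM leq_pexp2l // mulSn expnD leq_mul //.
apply: leq_trans (ltnW (ltn_expl x (ltnSn 1))) _.
by rewrite leq_pexp2l // leq_pmulr.
Qed.

Theorem theorem5p3 :
  exists (d C : nat) (P : program),
  forall (n : nat) (Q S G : finType) (M : mpa n Q S G) (q : Q),
    ordered M -> normal_form M ->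
    exists (E : finType) (A : m_automaton Q G E) (t : nat),
      [/\ computes P (code_input M q) (code_automaton A) t,
          t <= C * mpa_size M ^ (2 ^ (d * n)),
          aut_size A <= C * mpa_size M ^ (2 ^ (d * n)) &
          forall c : config n Q G,
            aut_lang A M c <-> pre_star M (fun c' => c' = empty_config M q) c].
Proof.
have [K [D w_le]] := weight_poly 1 main_prog.
(* The running time has degree [D] in the loop bound [N ^ 6], and the automaton has size at most
   [N ^ 12]; the sum of the exponents serves both, and the successor comes from [expn_tower]. *)
exists (6 * D + 12).+1, K.+1, (compile main_prog) => n Q S G M q _ M_nf.
have n_gt0 := stacks_gt0 M.
have [t t_le ct] := compile_correct (ok_main M q n_gt0).
have [_ _ _ _ m4] := m_bounds M q n_gt0.
set m := mpa_size M in m4 *.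
have m0 : 0 < m by apply: leq_trans m4.
have N0 : 0 < m ^ (2 ^ n) by rewrite expn_gt0 m0.
have tower := expn_tower (6 * D + 12) m0 n_gt0.
exists 'I_(size (extra_states M)), (pre_automaton M q), t; split.
- by rewrite -den_main.
- apply: leq_trans t_le _; apply: leq_trans (w_le _ _) _; first by rewrite expn_gt0 N0.
  rewrite -expnM; apply: leq_mul => //; apply: leq_trans tower.
  by rewrite leq_pexp2l // leq_addr.
- apply: leq_trans (aut_size_le M q n_gt0) _; rewrite -[X in X <= _]mul1n leq_mul //.
  by apply: leq_trans tower; rewrite leq_pexp2l // leq_addl.
- exact: aut_langP.
Qed.
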